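(* Let $0<p,q<\infty$ with $p\neq 2$ and $q\neq 2$. Then $(L_p,d_p)$ does not Lipschitz embed into $(\ell_q,d_q)$.
   Context: $L_p=L_p[0,1]$ (real). For $0<p\le 1$, $d_p$ denotes the metric $d_p(x,y)=\sum_{n}|x_n-y_n|^p$ on $\ell_p$ and $d_p(f,g)=\int_0^1|f(t)-g(t)|^p\,dt$ on $L_p$; for $p\ge 1$, $d_p$ denotes the usual norm metric on $\ell_p$, respectively $L_p$. A metric space $(\mathcal M_1,d_1)$ Lipschitz embeds into $(\mathcal M_2,d_2)$ if there are a one-to-one map $f:\mathcal M_1\to\mathcal M_2$ and constants $A,B>0$ with $A^{-1}d_1(x,y)\le d_2(f(x),f(y))\le B\,d_1(x,y)$ for all $x,y\in\mathcal M_1$. *)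

(* Defs.v *)
From mathcomp Require Import all_boot all_order all_algebra.
From mathcomp Require Import all_classical all_reals all_analysis.
Set Implicit Arguments.
Unset Strict Implicit.
Unset Printing Implicit Defensive.
Import Order.TTheory GRing.Theory Num.Theory.
Import numFieldNormedType.Exports.
Local Open Scope classical_set_scope.
Local Open Scope ring_scope.

Definition lebesgue01 (R : realType) :
    {measure set (measurableTypeR R) -> \bar R} :=
  mrestr (@lebesgue_measure R) (measurable_itv `[0 : R, 1]).

(* [LspaceType] requires [1 <= p]; this is the same space of [ae_eq]-classes
   for every real exponent. The classes are classes of Borel functions on [R];
   as [lebesgue01] vanishes outside [0, 1], only the values there matter. *)
Definition Lp_space (R : realType) (p : R) : Type :=
  {f : {mfun_ (lebesgue01 R), measurableTypeR R >-> measurableTypeR R}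
     | finite_norm (lebesgue01 R) p%:E f}.

Definition Lp_dist (R : realType) (p : R) (f g : Lp_space p) : R :=
  if p <= 1
  then fine (\int[lebesgue01 R]_t (`|sval f t - sval g t| `^ p)%:E)
  else fine ('N[lebesgue01 R]_p%:E[EFin \o (fun t => sval f t - sval g t)]).

(* the Lp-norm for the counting measure is the lp-norm, see [Lnorm_counting] *)
Definition lp_space (R : realType) (p : R) : Type :=
  {x : R^nat | finite_norm counting p%:E x}.

Definition lp_dist (R : realType) (p : R) (x y : lp_space p) : R :=
  if p <= 1
  then fine (\sum_(n <oo) (`|sval x n - sval y n| `^ p)%:E)
  else fine ('N[counting]_p%:E[EFin \o (fun n => sval x n - sval y n)]).

Definition lipschitz_embeds (R : realType) (M1 M2 : Type)
    (d1 : M1 -> M1 -> R) (d2 : M2 -> M2 -> R) : Prop :=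
  exists (f : M1 -> M2) (A B : R),
    [/\ injective f, 0 < A, 0 < B &
        forall x y, A^-1 * d1 x y <= d2 (f x) (f y) <= B * d1 x y].

(* Main.v *)
Require Import Defs.
From mathcomp Require Import all_boot all_order all_algebra.
From mathcomp Require Import all_classical all_reals all_analysis.
From mathcomp Require Import measurable_realfun.
From mathcomp Require Import ring lra.
From mathcomp Require Import zify.

(** Suppose that f embeds (L_p, d_p) into (l_q, d_q). Only the images of the
    dyadic step functions on [0, 1] matter. Their integrals are finite averages,
    and the n-th Rademacher function is independent of every step function of
    level n ([mean_rademacher]). Two obstructions cover all cases.

    Midpoints (p <= 1, or 1 < p and q < 2). In l_q, the points that are
    midpoints of x and y up to a relative error delta are within
    O(delta^(1/max(1,q))) d(x,y) of x outside a finite set of coordinates that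
    depends on x and y only: since a midpoint must already spend its whole
    budget on the coordinates that carry x - y, little is left for the others.
    Any sequence of such points therefore has two terms at a distance of that
    order ([lp_midpoints_close]). In L_p, with h = x - y, the points
    y + h (1 + e r_n) / 2, where r_n runs over late Rademacher functions, are
    - for p <= 1 and e = 1, exact midpoints, at mutual distance d(x,y)/2;
    - for p > 1, midpoints up to a relative error O(e^2), at mutual distance
      2^(-1/p) e d(x,y)
    ([dyadic_fun_midpoints]). If the pair (x, y) nearly attains the Lipschitz
    constant of f, then f maps midpoints of x and y to nearly midpoints of f x
    and f y ([near_extremal]). So the separation of the points in L_p is at most
    a constant times delta^(1/max(1,q)) ([no_embedding_midpoints]). For p <= 1
    let delta tend to 0. For p > 1 take delta of order e^2 and let e tend to 0:
    this is absurd as soon as 2/max(1,q) > 1.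

    Hamming graphs (1 < p and q > 2). Map a list of k indices to the sum of the
    corresponding Rademacher functions. Changing one index moves the sum by at
    most 2, while by Khintchine's inequality the sums over two disjoint lists
    are at distance at least c k^(1/2) ([rad_diff_lower]). In l_q, on the other
    hand, any map of lists of k indices that moves boundedly when one index
    changes takes two values, on disjoint lists, at distance O(k^(1/q))
    ([hamming_concentration]): replacing the indices one after the other by
    their weak limit perturbs the image by almost disjoint blocks, whose q-th
    powers add up. As 1/q < 1/2, this is absurd for large k. *)

Set Implicit Arguments.
Unset Strict Implicit.
Unset Printing Implicit Defensive.
Import Order.TTheory GRing.Theory Num.Theory.
Import numFieldNormedType.Exports.
Local Open Scope classical_set_scope.
Local Open Scope ring_scope.

(** * Sums of q-th powers *)

Section PowerSums.
Context {R : realType}.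
Implicit Types (q : R) (x y u v : nat -> R).

(** The best constant in |a + b|^q <= c (|a|^q + |b|^q), for all q > 0 at once. *)
Definition quasi_cst q : R := Num.max 1 (2 `^ (q - 1)).

Lemma quasi_cst_ge1 q : 1 <= quasi_cst q.
Proof. by rewrite /quasi_cst le_max lexx. Qed.

Lemma quasi_cst_gt0 q : 0 < quasi_cst q.
Proof. exact: lt_le_trans (quasi_cst_ge1 q). Qed.

(** Subadditivity of the power for q <= 1, its convexity at the middle point for
    q >= 1. *)
Lemma ler_powRD q (a b : R) : 0 < q -> 0 <= a -> 0 <= b ->
  (a + b) `^ q <= quasi_cst q * (a `^ q + b `^ q).
Proof.
move=> q0 a0 b0; have [q1|q1] := leP q 1.
  apply: (@le_trans _ _ (a `^ q + b `^ q)); last first.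
    by apply: ler_peMl; [apply: addr_ge0; exact: powR_ge0|exact: quasi_cst_ge1].
  have [s0|s0] := eqVneq (a + b) 0.
    by rewrite s0 powR0 ?gt_eqF// addr_ge0 ?powR_ge0.
  have sp : 0 < a + b by rewrite lt_def s0 addr_ge0.
  have key c : 0 <= c -> c <= a + b -> c / (a + b) * (a + b) `^ q <= c `^ q.
    move=> c0 cs; have [->|cn0] := eqVneq c 0.
      by rewrite !mul0r powR_ge0.
    have -> : c `^ q = (c / (a + b)) `^ q * (a + b) `^ q.
      by rewrite -powRM ?divfK//; [exact: divr_ge0 (ltW sp)|exact: ltW].
    apply: ler_wpM2r; first exact: powR_ge0.
    apply: ger1_powR => //; rewrite divr_gt0//; last by rewrite lt_neqAle eq_sym cn0.
    by rewrite ler_pdivrMr// mul1r.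
  apply: le_trans (lerD (key a _ _) (key b _ _)) => //; rewrite ?lerDl ?lerDr//.
  by rewrite -mulrDl -mulrDl divff// mul1r.
have H : (2^-1 * a + 2^-1 * b) `^ q <= 2^-1 * a `^ q + 2^-1 * b `^ q.
  rewrite {2 4}(_ : 2^-1 = 1 - 2^-1); last by field.
  by apply: (convex_powR (ltW q1) (Itv01 _ _)) => //=;
    rewrite ?inE/= ?in_itv/= ?andbT// ?invr_ge0// invf_le1 ?ler1n.
move: H; rewrite -!mulrDr powRM ?addr_ge0// => H.
have c2 : 2 `^ (q - 1) <= quasi_cst q by rewrite /quasi_cst le_max lexx orbT.
have s0 : 0 <= a `^ q + b `^ q by rewrite addr_ge0 ?powR_ge0.
apply: (@le_trans _ _ (2 `^ (q - 1) * (a `^ q + b `^ q))); last first.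
  exact: ler_wpM2r.
move: H; rewrite -(ler_pM2l (powR_gt0 q (ltr0Sn R 1))) mulrA -powRM//.
rewrite divff// powR1 mul1r => /le_trans; apply.
by rewrite mulrA powRB ?pnatr_eq0 ?implybT// powRr1.
Qed.

Lemma ler_powR_normD q (a b : R) : 0 < q ->
  `|a + b| `^ q <= quasi_cst q * (`|a| `^ q + `|b| `^ q).
Proof.
move=> q0; apply: le_trans (ler_powRD q0 (normr_ge0 a) (normr_ge0 b)).
by apply: ge0_ler_powR; rewrite ?nnegrE// ?addr_ge0 ?ler_normD// ltW.
Qed.

Lemma ler_powR_normB q (a b : R) : 0 < q ->
  `|a - b| `^ q <= quasi_cst q * (`|a| `^ q + `|b| `^ q).
Proof. by move=> q0; rewrite -(normrN b); exact: ler_powR_normD. Qed.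

Lemma cvg_powR_norm (T : Type) (F : set_system T) {FF : Filter F} q
    (g : T -> R) (l : R) : 0 < q ->
  g @ F --> l -> `|g t| `^ q @[t --> F] --> `|l| `^ q.
Proof.
move=> q0 gl; have [l0|l0] := eqVneq l 0.
  move: gl; rewrite l0 => gl.
  rewrite normr0 powR0 ?gt_eqF//.
  apply/cvgrPdist_lt => e e0.
  move/cvgrPdist_lt : gl => /(_ (e `^ q^-1) (powR_gt0 _ e0)).
  apply: filterS => t; rewrite !sub0r !normrN (ger0_norm (powR_ge0 _ _)) => H.
  have {1}-> : e = (e `^ q^-1) `^ q.
    by rewrite -powRrM mulVf ?gt_eqF// powRr1// ltW.
  by apply: gt0_ltr_powR; rewrite // nnegrE// powR_ge0.
have gl' : `|g t| @[t --> F] --> `|l| by exact: (cvg_norm gl).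
apply: (continuous_cvg (h := fun a => a `^ q) _ _ gl').
apply/differentiable_continuous/derivable1_diffP/derivable_powR.
by rewrite in_itv/= normr_gt0 l0.
Qed.

(** Real bounds on all partial sums replace the series in the extended reals; they
    pass to coordinatewise limits. *)
Definition power_sum q x N := \sum_(i < N) `|x i| `^ q.

Definition power_sum_bounded q x (M : R) := forall N, power_sum q x N <= M.

Lemma power_sum_nd q x N M : (N <= M)%N -> power_sum q x N <= power_sum q x M.
Proof.
move=> NM; rewrite /power_sum -!(big_mkord xpredT (fun i => `|x i| `^ q)).
rewrite [leRHS](big_cat_nat (leq0n N) NM)//= lerDl.
by apply: sumr_ge0 => i _; exact: powR_ge0.
Qed.

Lemma power_sum_ge0 q x N : 0 <= power_sum q x N.
Proof. by apply: sumr_ge0 => i _; exact: powR_ge0. Qed.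

Lemma power_sumB q x y N : 0 < q ->
  power_sum q (fun i => x i - y i) N <= quasi_cst q * (power_sum q x N + power_sum q y N).
Proof.
move=> q0; rewrite /power_sum -big_split/= mulr_sumr.
by apply: ler_sum => i _; exact: ler_powR_normB.
Qed.

Lemma cvg_power_sum (T : Type) (F : set_system T) {FF : Filter F} q
    (X : T -> nat -> R) x N : 0 < q ->
  (forall i, X t i @[t --> F] --> x i) ->
  power_sum q (X t) N @[t --> F] --> power_sum q x N.
Proof.
move=> q0 Xx; elim: N => [|N IH].
  rewrite /power_sum big_ord0; under eq_fun do rewrite big_ord0.
  exact: cvg_cst.
rewrite /power_sum big_ord_recr/=; under eq_fun do rewrite big_ord_recr/=.
by apply: cvgD; [exact: IH|exact: cvg_powR_norm].
Qed.

Lemma power_sum_bounded_tail q x M e : power_sum_bounded q x M -> 0 < e ->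
  exists N, forall N', power_sum q x N' <= power_sum q x N + e.
Proof.
move=> xM e0; pose E := range (power_sum q x).
have hE : has_sup E.
  by split; [exists (power_sum q x 0), 0%N|exists M => _ [n _ <-]; exact: xM].
have [_ [N _ <-] HN] := sup_adherent e0 hE.
exists N => N'.
have : power_sum q x N' <= sup E by apply: sup_upper_bound => //; exists N'.
lra.
Qed.

End PowerSums.
(** * Weak limits of sequences *)

Section UltraLimits.
Context {R : realType}.
Implicit Types (q : R) (x y u v : nat -> R).

(** Limits along one fixed ultrafilter give all the compactness that is needed:
    every bounded real sequence converges along it, with no subsequence to
    extract. *)
Lemma ultra_nat : exists2 U : set_system nat, UltraFilter U &
  forall m, U [set n | (m < n)%N].
Proof.
have [U [UU subU]] := ultraFilterLemma eventually_filter.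
by exists U => // m; apply: subU; exists m.+1.
Qed.

Lemma ultra_fmap (T V : Type) (g : T -> V) (U : set_system T) :
  UltraFilter U -> UltraFilter (g @ U).
Proof.
move=> UU; split => [|G PG UG]; first exact: fmap_proper_filter.
apply/seteqP; split => // A GA.
have [//|UnA] := in_ultra_setVsetC (g @^-1` A) UU.
have GnA : G (~` A) by exact: UG.
by have [z []] := filter_ex (filterI GA GnA).
Qed.

Lemma ultra_cvg_bounded (T : Type) (U : set_system T) (g : T -> R) (M : R) :
  UltraFilter U -> (forall t, `|g t| <= M) -> exists l : R, g @ U --> l.
Proof.
move=> UU gM.
have UgU : UltraFilter (g @ U) by exact: ultra_fmap.
have := @segment_compact R (- M) M; rewrite compact_ultra => /(_ _ UgU).
case=> [|l [_ gl]]; last by exists l.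
apply: (@filterS _ U _ setT); last exact: filterT.
by move=> t _; rewrite /= in_itv/= -ler_norml.
Qed.

(** Fatou's lemma for coordinatewise limits, here through finite sums. *)
Lemma power_sum_bounded_cvg (T : Type) (U : set_system T) {PU : ProperFilter U} q
    (X : T -> nat -> R) x M : 0 < q ->
  (forall i, X t i @[t --> U] --> x i) ->
  (forall t, power_sum_bounded q (X t) M) -> power_sum_bounded q x M.
Proof.
move=> q0 Xx XM N; 
have XN : power_sum q (X t) N @[t --> U] --> power_sum q x N by exact: cvg_power_sum.
by apply: (cvgr_to_le XN); apply: nearW => t; exact: XM.
Qed.

Lemma power_sum_tail q x N N' : (N <= N')%N ->
  power_sum q x N' = power_sum q x N + \sum_(N <= i < N') `|x i| `^ q.
Proof.
move=> NN; rewrite /power_sum -!(big_mkord xpredT (fun i => `|x i| `^ q)).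
by rewrite (big_cat_nat (leq0n N) NN).
Qed.

Lemma power_sum_term q x i : `|x i| `^ q <= power_sum q x i.+1.
Proof. by rewrite /power_sum big_ord_recr/= lerDr; exact: power_sum_ge0. Qed.

Lemma power_sum_bounded_term q x M i : 0 < q -> power_sum_bounded q x M ->
  `|x i| <= M `^ q^-1.
Proof.
move=> q0 xM; have M0 : 0 <= M by apply: le_trans (xM 0%N); exact: power_sum_ge0.
have -> : `|x i| = (`|x i| `^ q) `^ q^-1.
  by rewrite -powRrM divff ?gt_eqF// powRr1.
apply: ge0_ler_powR; rewrite ?nnegrE ?powR_ge0//; first by rewrite invr_ge0 ltW.
by apply: le_trans (xM i.+1); exact: power_sum_term.
Qed.

Lemma power_sumB_tail q x y N N' : 0 < q -> (N <= N')%N ->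
  power_sum q (fun i => x i - y i) N' <= power_sum q (fun i => x i - y i) N +
   quasi_cst q * ((power_sum q x N' - power_sum q x N) +
                  (power_sum q y N' - power_sum q y N)).
Proof.
move=> q0 NN; rewrite !(power_sum_tail q _ NN) lerD2l.
rewrite (addrC (power_sum q x N)) (addrC (power_sum q y N)) !addrK.
rewrite -big_split/= mulr_sumr.
by apply: ler_sum => i _; exact: ler_powR_normB.
Qed.

Lemma power_sumD_tail q x y N N' : 0 < q -> (N <= N')%N ->
  power_sum q (fun i => x i + y i) N' <= power_sum q (fun i => x i + y i) N +
   quasi_cst q * ((power_sum q x N' - power_sum q x N) +
                  (power_sum q y N' - power_sum q y N)).
Proof.
move=> q0 NN; rewrite !(power_sum_tail q _ NN) lerD2l.
rewrite (addrC (power_sum q x N)) (addrC (power_sum q y N)) !addrK.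
rewrite -big_split/= mulr_sumr.
by apply: ler_sum => i _; exact: ler_powR_normD.
Qed.

(** On the first [N] coordinates, |z_i - u_i|^q + |z_i - v_i|^q is at least
    |u_i - v_i|^q / c, and these coordinates carry almost all of S. If the two
    distances to z are those of an approximate midpoint, nothing but a multiple
    of d S remains for the tail of z - u. *)
Lemma midpoint_tail q u v (z : nat -> R) S D d N :
  0 < q -> 0 <= d -> S <= power_sum q (fun i => u i - v i) N + d * S ->
  power_sum_bounded q (fun i => z i - u i) D ->
  power_sum_bounded q (fun i => z i - v i) D ->
  quasi_cst q * (2 * D) <= (1 + d) * S ->
  forall N', (N <= N')%N ->
  quasi_cst q * (power_sum q (fun i => z i - u i) N' - power_sum q (fun i => z i - u i) N)
   <= 2 * d * S.
Proof.
move=> q0 d0 SN zu zv DS N' NN.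
have H : power_sum q (fun i => u i - v i) N <= quasi_cst q *
    (power_sum q (fun i => z i - u i) N + power_sum q (fun i => z i - v i) N).
  have := @power_sumB _ q (fun i => z i - v i) (fun i => z i - u i) N q0.
  rewrite (_ : (fun _ => _) = fun i => u i - v i); last first.
    by apply/funext => i; ring.
  by rewrite [X in _ * X]addrC.
have zv' := power_sum_nd q (fun i => z i - v i) NN.
have := zu N'; have := zv N'; have := quasi_cst_gt0 q; move: H zv'.
move: DS SN; set c := quasi_cst q; set a := power_sum _ _ N; set b := power_sum _ _ N.
set b' := power_sum _ _ N; set a' := power_sum _ _ N'; set e := power_sum _ _ N'.
move=> DS SN H1 H2 c0 H3 H4.
have : c * (a' + e) <= c * (2 * D) by rewrite ler_pM2l//; lra.
have : 0 <= c * (a' - b') by rewrite mulr_ge0 ?subr_ge0// ltW.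
lra.
Qed.

(** Tails are small by [midpoint_tail]; on the finitely many other coordinates the
    sequence converges along the ultrafilter, so two of its terms agree there up
    to an arbitrary error. *)
Lemma midpoints_close q u v (Z : nat -> nat -> R) (S D d : R) :
  0 < q -> 0 < d -> 0 < S ->
  power_sum_bounded q (fun i => u i - v i) S ->
  (forall M, power_sum_bounded q (fun i => u i - v i) M -> S <= M) ->
  quasi_cst q * (2 * D) <= (1 + d) * S ->
  (forall n, power_sum_bounded q (fun i => Z n i - u i) D) ->
  (forall n, power_sum_bounded q (fun i => Z n i - v i) D) ->
  exists n m, (n < m)%N /\
    power_sum_bounded q (fun i => Z n i - Z m i) (5 * d * S).
Proof.
move=> q0 d0 S0 uvS Smin DS Zu Zv.
have c0 := quasi_cst_gt0 q.
have [N HN] := power_sum_bounded_tail uvS (mulr_gt0 d0 S0).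
have SN := Smin _ HN.
have [U UU Uoo] := ultra_nat.
have /choice[z Hz] i : exists l : R, Z n i - u i @[n --> U] --> l.
  apply: (@ultra_cvg_bounded _ _ _ (D `^ q^-1)) => n.
  exact: (power_sum_bounded_term i q0 (Zu n)).
have cvgZ : power_sum q (fun i => (Z n i - u i) - z i) N @[n --> U] --> 0.
  have -> : 0 = power_sum q (fun i => z i - z i) N.
    rewrite /power_sum big1// => i _; rewrite subrr normr0 powR0// gt_eqF//.
  apply: cvg_power_sum => // i; apply: cvgB; [exact: Hz|exact: cvg_cst].
(* this makes the first N coordinates contribute at most d S below *)
have e0 : 0 < d * S / (2 * quasi_cst q) by rewrite divr_gt0 ?mulr_gt0.
have UE : U [set n | power_sum q (fun i => (Z n i - u i) - z i) N
    < d * S / (2 * quasi_cst q)] by exact: cvgr_lt cvgZ _ e0.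
have [n En] := filter_ex UE.
have [m [Em nm]] := filter_ex (filterI UE (Uoo n)).
exists n, m; split => // N'.
apply: (le_trans (power_sum_nd q _ (leq_maxr N N'))).
have NN := leq_maxl N N'; move: (maxn N N') NN => {}N' NN.
have := @power_sumB_tail q (fun i => Z n i - u i) (fun i => Z m i - u i)
  N N' q0 NN.
have E : (fun i => Z n i - u i - (Z m i - u i)) = fun i => Z n i - Z m i.
  by apply/funext => i; ring.
rewrite E.
have := @power_sumB _ q (fun i => Z n i - u i - z i)
  (fun i => Z m i - u i - z i) N q0.
have -> : (fun i => Z n i - u i - z i - (Z m i - u i - z i)) =
    fun i => Z n i - Z m i by apply/funext => i; ring.
have := midpoint_tail q0 (ltW d0) SN (Zu n) (Zv n) DS NN.
have := midpoint_tail q0 (ltW d0) SN (Zu m) (Zv m) DS NN.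
move: En Em; rewrite /= !ltr_pdivlMr ?mulr_gt0//.
lra.
Qed.

(** A weakly null sequence is asymptotically disjoint from a fixed vector, so the
    q-th powers add up, with constant 1 in front of the fixed vector. That
    constant is what keeps the growth linear when the step is iterated. *)
Lemma power_sum_bounded_perturb (U : set_system nat) {PU : ProperFilter U} q x
    (X : nat -> nat -> R) (M L : R) : 0 < q ->
  power_sum_bounded q x M -> (forall n, power_sum_bounded q (X n) L) ->
  (forall i, X n i @[n --> U] --> 0) ->
  U [set n | power_sum_bounded q (fun i => x i + X n i) (M + (1 + quasi_cst q * (1 + L)))].
Proof.
move=> q0 xM XL X0.
(* the head of x + X n converges to the head of x; the tail of x is at most 1 *)
have [N HN] := power_sum_bounded_tail xM ltr01.
have cvgx : power_sum q (fun i => x i + X n i) N @[n --> U] --> power_sum q x N.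
  apply: cvg_power_sum => // i; rewrite -[X in _ --> X]addr0.
  by apply: cvgD; [exact: cvg_cst|exact: X0].
have lt1 : power_sum q x N < power_sum q x N + 1 by rewrite ltrDl.
have Ux : U [set n | power_sum q (fun i => x i + X n i) N < power_sum q x N + 1].
  exact: cvgr_lt cvgx _ lt1.
apply: filterS Ux => n /= xn N'.
apply: (le_trans (power_sum_nd q _ (leq_maxr N N'))).
have NN := leq_maxl N N'; move: (maxn N N') NN => {}N' NN.
have := @power_sumD_tail q x (X n) N N' q0 NN.
have H1 := HN N'; have H2 := XL n N'; have H3 := power_sum_ge0 q (X n) N.
have H4 := xM N.
move/le_trans; apply.
rewrite [leRHS]addrA; apply: lerD; first lra.
by rewrite ler_pM2l ?quasi_cst_gt0//; lra.
Qed.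

(** Induction on the number of indices. The induction hypothesis applies to the
    weak limit F' of F in its first index; going back from F' to F adds to
    F'(s) - F'(t) two weakly null terms, which cost a bounded amount each. The
    indices are chosen one after the other, each one greater than all the
    previous ones, so the two lists are interlaced; this makes them disjoint and
    puts the Rademacher functions that they select in order. *)
Lemma hamming_concentration q (L : R) (k : nat) (F : seq nat -> nat -> R) :
  0 < q ->
  (forall s t a b, (size s + size t).+1 = k ->
    power_sum_bounded q (fun i => F (s ++ a :: t) i - F (s ++ b :: t) i) L) ->
  exists w : seq (nat * nat), [/\ size w = k,
    sorted gtn (flatten [seq [:: ab.2; ab.1] | ab <- w]) &
    power_sum_bounded q (fun i => F (unzip1 w) i - F (unzip2 w) i)
      (k%:R * (2 * (1 + quasi_cst q * (1 + L))))].
Proof.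
move=> q0; have [U UU Uoo] := ultra_nat.
elim: k F => [|k IH] F FL.
  exists [::]; split => // N; rewrite mul0r /power_sum big1// => i _.
  by rewrite subrr normr0 powR0// gt_eqF.
have Fcvg s i : size s = k -> exists l : R, F (n :: s) i @[n --> U] --> l.
  move=> sk.
  have [l Hl] : exists l : R, F (n :: s) i - F (0%N :: s) i @[n --> U] --> l.
    apply: (@ultra_cvg_bounded _ _ _ (L `^ q^-1)) => n.
    by apply: (power_sum_bounded_term i q0 (FL [::] s n 0%N _)); rewrite /= add0n sk.
  exists (l + F (0%N :: s) i).
  rewrite -[X in X @ _](_ : (fun n => F (n :: s) i - F (0%N :: s) i + F (0%N :: s) i) = _).
    by apply: cvgD; [exact: Hl|exact: cvg_cst].
  by apply/funext => n; rewrite subrK.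
pose F' s i := lim (F (n :: s) i @[n --> U]).
have cvgF s i : size s = k -> F (n :: s) i @[n --> U] --> F' s i.
  by move=> /(Fcvg s i)[l /cvgP].
have F'L s t a b : (size s + size t).+1 = k ->
    power_sum_bounded q (fun i => F' (s ++ a :: t) i - F' (s ++ b :: t) i) L.
  move=> stk.
  apply: (@power_sum_bounded_cvg _ U _ _
    (fun n i => F (n :: s ++ a :: t) i - F (n :: s ++ b :: t) i)) => // [i|n].
    by apply: cvgB; apply: cvgF; rewrite size_cat/= addnS.
  by apply: (FL (n :: s)); rewrite /= addSn stk.
have [w [wk ws wF]] := IH _ F'L.
have F'F s n : size s = k -> power_sum_bounded q (fun i => F (n :: s) i - F' s i) L.
  move=> sk.
  apply: (@power_sum_bounded_cvg _ U _ _ (fun m i => F (n :: s) i - F (m :: s) i)) => //.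
    by move=> i; apply: cvgB; [exact: cvg_cst|exact: cvgF].
  by move=> m; apply: (FL [::]); rewrite /= add0n sk.
set C := 1 + quasi_cst q * (1 + L) in wF *.
have cvg0 s i : size s = k -> F (n :: s) i - F' s i @[n --> U] --> 0.
  move=> sk; rewrite -[X in _ --> X](subrr (F' s i)).
  by apply: cvgB; [exact: cvgF|exact: cvg_cst].
have s1 : size (unzip1 w) = k by rewrite size_map.
have s2 : size (unzip2 w) = k by rewrite size_map.
(* The list is decreasing, so its head bounds every index used so far. *)
pose top := head 0%N (flatten [seq [:: ab.2; ab.1] | ab <- w]).
have [a [/= aF atop]] := filter_ex (filterI
  (power_sum_bounded_perturb q0 wF (fun n => F'F _ n s1) (fun i => cvg0 _ i s1))
  (Uoo top)).
have {}aF : power_sum_bounded q (fun i => F (a :: unzip1 w) i - F' (unzip2 w) i)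
    (k%:R * (2 * C) + C).
  move: aF; congr (power_sum_bounded _ _ _); apply/funext => i; ring.
have F'FN n : power_sum_bounded q (fun i => - (F (n :: unzip2 w) i - F' (unzip2 w) i)) L.
  move=> N; rewrite /power_sum; under eq_bigr do rewrite normrN; exact: F'F.
have cvg0N i : - (F (n :: unzip2 w) i - F' (unzip2 w) i) @[n --> U] --> 0.
  by rewrite -oppr0; apply: cvgN; exact: cvg0.
have [b [/= bF ba]] := filter_ex (filterI
  (power_sum_bounded_perturb q0 aF F'FN cvg0N) (Uoo a)).
exists ((a, b) :: w); split => /=; first by rewrite wk.
- rewrite ba/=; move: ws atop; rewrite /top.
  by case: (flatten _) => //= c l -> ->.
- move: bF; rewrite -/C (_ : _ + C + C = k.+1%:R * (2 * C)); last first.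
    by rewrite -[k.+1%:R]natr1; ring.
  congr (power_sum_bounded _ _ _); apply/funext => i /=.
  by rewrite -/(unzip1 w) -/(unzip2 w); ring.
Qed.

End UltraLimits.
(** * Dyadic step functions *)

Section Dyadic.
Context {R : realType}.
Implicit Types (f g : R -> R) (t : R) (a : nat -> R).

(** On [0, 1[ this is the index of the dyadic interval of length 2^-n around t.
    Negative reals fall in cell 0; reals from 1 on fall in cells of index at least
    2^n, which meet [0, 1] in the point 1 only. *)
Definition cell (n : nat) t : nat := Num.truncn (2 ^+ n * t).

Lemma cellS n t : cell n t = (cell n.+1 t)./2.
Proof.
have [t0|t0] := leP 0 t; last first.
  have E m : cell m t = 0%N.
    rewrite /cell; apply/truncn0Pn; rewrite -ltNge (lt_trans _ ltr01)//.
    by rewrite pmulr_rlt0// exprn_gt0.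
  by rewrite !E.
have H m : 0 <= 2 ^+ m * t by rewrite mulr_ge0// exprn_ge0.
apply/eqP; rewrite truncn_eq//.
have /andP[] := truncn_itv (H n.+1); rewrite -/(cell n.+1 t) exprS -mulrA.
set c := cell _ _; set s := 2 ^+ n * t => h1 h2.
have := odd_double_half c; set h := c./2; have := leq_b1 (odd c) => h3 h4.
have h5 : (2 * h <= c)%N by lia.
have h6 : (c.+1 <= 2 * h.+1)%N by lia.
move: h5 h6; rewrite -!(ler_nat R) !natrM => h5 h6.
by apply/andP; split; lra.
Qed.

(** The values of [a] at all indices are free, so that these functions are defined
    on R and closed under pointwise operations without side condition. *)
Definition dyadic (n : nat) f := exists a, forall t, f t = a (cell n t).

Lemma dyadic_le n m f : (n <= m)%N -> dyadic n f -> dyadic m f.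
Proof.
elim: m => [|m IH]; first by rewrite leqn0 => /eqP ->.
rewrite leq_eqVlt => /orP[/eqP -> //|]; rewrite ltnS => /IH /[apply].
by case=> a fa; exists (fun i => a i./2) => t; rewrite fa cellS.
Qed.

Lemma dyadic_cst n (c : R) : dyadic n (fun=> c).
Proof. by exists (fun=> c). Qed.

Lemma dyadic_comp n (P : R -> R) f : dyadic n f -> dyadic n (fun t => P (f t)).
Proof. by case=> a fa; exists (P \o a) => t; rewrite fa. Qed.

Lemma dyadic_comp2 n (P : R -> R -> R) f g : dyadic n f -> dyadic n g ->
  dyadic n (fun t => P (f t) (g t)).
Proof.
by case=> a fa [b gb]; exists (fun i => P (a i) (b i)) => t; rewrite fa gb.
Qed.

Definition rademacher (n : nat) t : R := (-1) ^+ odd (cell n.+1 t).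

Lemma dyadic_rademacher n : dyadic n.+1 (rademacher n).
Proof. by exists (fun i => (-1) ^+ odd i). Qed.

Lemma measurable_cell n : measurable_fun [set: measurableTypeR R] (cell n).
Proof.
move=> _ Y _; rewrite setTI.
have -> : cell n @^-1` Y = \bigcup_(j in Y) [set t | cell n t = j].
  apply/seteqP; split => [t Yt|t [j Yj /= tj]]; first by exists (cell n t).
  by rewrite /preimage/= tj.
apply: bigcup_measurable => j _.
have n0 : 0 < 2 ^+ n :> R by rewrite exprn_gt0.
case: j => [|j].
  rewrite (_ : mkset _ = `]-oo, (2 ^+ n)^-1[%classic); first exact: measurable_itv.
  apply/seteqP; split => t /=; rewrite in_itv/=.
    move/truncn0Pn; rewrite -ltNge => h.
    by rewrite -[ltRHS]mulr1 mulrC ltr_pdivlMr// mulrC.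
  rewrite -[ltRHS]mulr1 mulrC ltr_pdivlMr// mulrC => h.
  by apply/truncn0Pn; rewrite -ltNge.
rewrite (_ : mkset _ = `[j.+1%:R / 2 ^+ n, j.+2%:R / 2 ^+ n[%classic).
  exact: measurable_itv.
apply/seteqP; split => t /=; rewrite in_itv/= ler_pdivrMr// ltr_pdivlMr// (mulrC t).
  move=> h; have h0 : 0 <= 2 ^+ n * t.
    rewrite leNgt; apply/negP => tn.
    have : cell n t = 0%N by apply/truncn0Pn; rewrite -ltNge (lt_trans tn).
    by rewrite h.
  by rewrite -truncn_eq//; apply/eqP.
move=> h; apply/eqP; rewrite truncn_eq//.
by case/andP: h => h _; apply: le_trans h.
Qed.

Lemma measurable_dyadic n f : dyadic n f ->
  measurable_fun [set: measurableTypeR R] (f : _ -> measurableTypeR R).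
Proof.
case=> a fa; rewrite (_ : f = a \o cell n); last by apply/funext => t; rewrite fa.
move=> _ Y mY; rewrite setTI comp_preimage.
by have := @measurable_cell n measurableT (a @^-1` Y) I; rewrite setTI.
Qed.

Definition cellset n (j : nat) : set (measurableTypeR R) :=
  `[j%:R / 2 ^+ n, j.+1%:R / 2 ^+ n[%classic.

Lemma cellsetP n j t : cellset n j t -> cell n t = j.
Proof.
have n0 : 0 < 2 ^+ n :> R by rewrite exprn_gt0.
rewrite /cellset/= in_itv/= ler_pdivrMr// ltr_pdivlMr// (mulrC t) => h.
apply/eqP; rewrite truncn_eq//.
by case/andP: h => h _; apply: le_trans h.
Qed.

Lemma cellset_cell n t : 0 <= t -> cellset n (cell n t) t.
Proof.
move=> t0; have n0 : 0 < 2 ^+ n :> R by rewrite exprn_gt0.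
rewrite /cellset/= in_itv/= ler_pdivrMr// ltr_pdivlMr// (mulrC t).
by apply: truncn_itv; rewrite mulr_ge0// ltW.
Qed.

Lemma cell_lt n t : 0 <= t -> t < 1 -> (cell n t < 2 ^ n)%N.
Proof.
move=> t0 t1; have n0 : 0 < 2 ^+ n :> R by rewrite exprn_gt0.
rewrite truncn_lt_nat ?mulr_ge0// ?(ltW n0)// natrX.
by rewrite -[ltRHS]mulr1 ltr_pM2l.
Qed.

Lemma lebesgue01_cellset n j : (j < 2 ^ n)%N ->
  lebesgue01 R (cellset n j) = ((2 ^+ n)^-1)%:E.
Proof.
move=> jn; have n0 : 0 < 2 ^+ n :> R by rewrite exprn_gt0.
rewrite /lebesgue01/= /mrestr setIidl; last first.
  move=> t; rewrite /cellset/= !in_itv/= => /andP[h1 h2]; apply/andP; split.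
    by apply: le_trans h1; rewrite divr_ge0// ltW.
  apply: ltW; apply: (lt_le_trans h2); rewrite ler_pdivrMr// mul1r.
  by rewrite -natrX ler_nat.
rewrite lebesgue_measure_itv/= lte_fin ltr_pM2r ?invr_gt0// ltr_nat ltnSn.
by rewrite -EFinD -mulrBl -natrB// subSnn mul1r.
Qed.

Definition cellavg n a : R := (2 ^+ n)^-1 * \sum_(i < 2 ^ n) a i.

Lemma integral_dyadic n a f : (forall i, 0 <= a i) ->
  (forall t, f t = a (cell n t)) ->
  (\int[lebesgue01 R]_t (f t)%:E = (cellavg n a)%:E)%E.
Proof.
move=> a0 fa.
have mf : measurable_fun [set: measurableTypeR R] (fun t => (f t)%:E).
  by apply/measurable_EFinP; apply: (@measurable_dyadic n); exists a.
pose D := \big[setU/set0]_(j <- iota 0 (2 ^ n)) cellset n j.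
have mC j : measurable (cellset n j) by exact: measurable_itv.
have mD : measurable D by exact: bigsetU_measurable.
(* outside the 2^n cells of [0, 1[ only the point 1 is left *)
rewrite (@ge0_negligible_integral _ _ _ _ setT (~` D)) //=; last 3 first.
- exact: measurableC.
- by move=> t _; rewrite lee_fin fa.
- rewrite /mrestr; apply/eqP; rewrite -measure_le0.
  rewrite -(lebesgue_measure_set1 (1 : R)).
  apply: le_measure; rewrite ?inE//=.
    by apply: measurableI; [exact: measurableC|exact: measurable_itv].
  move=> t [nD]; rewrite /= in_itv/= => /andP[t0]; rewrite le_eqVlt => /orP[/eqP//|t1].
  exfalso; apply: nD; rewrite /D -bigcup_seq.
  exists (cell n t) => /=; last exact: cellset_cell.
  by rewrite mem_iota add0n cell_lt.
rewrite setTD setCK ge0_integral_bigsetU//=; last 4 first.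
- exact: iota_uniq.
- apply/trivIsetP => i j _ _ ij; apply/seteqP; split => // t.
  by case=> /cellsetP h1 /cellsetP h2; move: ij; rewrite -h1 -h2 eqxx.
- exact: measurable_funS mf.
- by move=> t _; rewrite lee_fin fa.
transitivity (\sum_(j <- iota 0 (2 ^ n)) ((2 ^+ n)^-1 * a j)%:E)%E.
  apply: eq_big_seq => j; rewrite mem_iota add0n => /= jn.
  rewrite (eq_integral (cst (a j)%:E)); last first.
    by move=> t; rewrite inE => /cellsetP; rewrite fa => ->.
  by rewrite integral_cst// lebesgue01_cellset// -EFinM mulrC.
rewrite sumEFin /cellavg mulr_sumr -(big_mkord xpredT (fun i => (2 ^+ n)^-1 * a i)).
by rewrite /index_iota subn0.
Qed.

End Dyadic.
(** * Integrals of dyadic step functions and their classes in L_p *)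

Section Mean.
Context {R : realType}.
Implicit Types (f g : R -> R) (t : R) (a : nat -> R).

(** Used for nonnegative step functions only, where the integral is finite. *)
Definition mean f : R := fine (\int[lebesgue01 R]_t (f t)%:E)%E.

(** So a nonnegative step function has nonnegative values at all indices. *)
Lemma cell_surj n i : exists t : R, cell n t = i.
Proof.
have n0 : 0 < 2 ^+ n :> R by rewrite exprn_gt0.
by exists (i%:R / 2 ^+ n); rewrite /cell mulrC divfK ?natrK// gt_eqF.
Qed.

Lemma mean_cellavg n a f : (forall t, f t = a (cell n t)) ->
  (forall t, 0 <= f t) ->
  (\int[lebesgue01 R]_t (f t)%:E = (cellavg n a)%:E)%E /\ mean f = cellavg n a.
Proof.
move=> fa f0; have a0 i : 0 <= a i.
  by have [t <-] := cell_surj n i; rewrite -fa.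
by rewrite /mean (integral_dyadic a0 fa).
Qed.

Lemma mean_fin n f : dyadic n f -> (forall t, 0 <= f t) ->
  (\int[lebesgue01 R]_t (f t)%:E = (mean f)%:E)%E.
Proof. by case=> a fa f0; have [-> ->] := mean_cellavg fa f0. Qed.

Lemma meanD n f g : dyadic n f -> dyadic n g ->
  (forall t, 0 <= f t) -> (forall t, 0 <= g t) ->
  mean (fun t => f t + g t) = mean f + mean g.
Proof.
case=> a fa [b gb] f0 g0.
rewrite (mean_cellavg fa f0).2 (mean_cellavg gb g0).2.
rewrite (@mean_cellavg n (fun i => a i + b i) _ _ _).2.
- by rewrite /cellavg big_split mulrDr.
- by move=> t; rewrite fa gb.
- by move=> t; rewrite addr_ge0.
Qed.

Lemma meanZ n (c : R) f : dyadic n f -> 0 <= c -> (forall t, 0 <= f t) ->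
  mean (fun t => c * f t) = c * mean f.
Proof.
case=> a fa c0 f0; rewrite (mean_cellavg fa f0).2.
rewrite (@mean_cellavg n (fun i => c * a i) _ _ _).2.
- by rewrite /cellavg -mulr_sumr mulrCA.
- by move=> t; rewrite fa.
- by move=> t; rewrite mulr_ge0.
Qed.

Lemma mean_cst (c : R) : 0 <= c -> mean (fun=> c) = c.
Proof.
move=> c0; rewrite (@mean_cellavg 0 (fun=> c) _ _ _).2//.
by rewrite /cellavg expr0 invr1 mul1r expn0 big_ord1.
Qed.

Lemma mean_ge0 n f : dyadic n f -> (forall t, 0 <= f t) -> 0 <= mean f.
Proof.
move=> df f0; rewrite -lee_fin -(mean_fin df f0).
by apply: integral_ge0 => t _; rewrite lee_fin.
Qed.

Lemma mean_le n f g : dyadic n f -> dyadic n g ->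
  (forall t, 0 <= f t) -> (forall t, f t <= g t) -> mean f <= mean g.
Proof.
move=> df dg f0 fg.
have E : g = fun t => f t + (g t - f t) by apply/funext => t; ring.
have dgf : dyadic n (fun t => g t - f t) by exact: (dyadic_comp2 (fun x y => x - y)).
rewrite [in leRHS]E (@meanD n)//; last by move=> t; rewrite subr_ge0.
by rewrite lerDl; apply: (mean_ge0 dgf) => t; rewrite subr_ge0.
Qed.

Lemma sum_double (h : nat -> R) m :
  \sum_(i < m.*2) h i = \sum_(i < m) (h i.*2 + h i.*2.+1).
Proof.
elim: m => [|m IH]; first by rewrite !big_ord0.
by rewrite doubleS !big_ord_recr/= IH addrA.
Qed.

(** Independence: inside each cell of level n, the n-th Rademacher function takes
    both signs on halves of equal length. *)
Lemma mean_rademacher n (P : R -> R -> R) :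
  dyadic n (P ^~ 1) -> dyadic n (P ^~ (-1)) ->
  (forall t, 0 <= P t 1) -> (forall t, 0 <= P t (-1)) ->
  mean (fun t => P t (rademacher n t)) = (mean (P ^~ 1) + mean (P ^~ (-1))) / 2.
Proof.
case=> a fa [b gb] f0 g0.
rewrite (mean_cellavg fa f0).2 (mean_cellavg gb g0).2.
rewrite (@mean_cellavg n.+1 (fun i => if odd i then b i./2 else a i./2) _ _ _).2.
- rewrite /cellavg expnS mul2n (sum_double (fun i => if odd i then b i./2 else a i./2)).
  rewrite (eq_bigr (fun i : 'I_(2 ^ n) => a i + b i)); last first.
    by move=> i _; rewrite /= odd_double doubleK uphalf_double.
  by rewrite big_split/= exprS invfM; field; rewrite expf_neq0.
- by move=> t; rewrite -cellS -fa -gb /rademacher; case: odd => //=; rewrite expr1.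
- by move=> t; rewrite /rademacher; case: odd.
Qed.

(** Turns the integral (or sum) of p-th powers into the distance d_p. *)
Definition dist_of_power (p s : R) : R := if p <= 1 then s else s `^ p^-1.

Definition represents (p : R) (F : @Lp_space R p) f :=
  (sval F : R -> R) = f %[ae lebesgue01 R].

Lemma integral_represents p (F G : @Lp_space R p) n f g : dyadic n f -> dyadic n g ->
  represents F f -> represents G g ->
  (\int[lebesgue01 R]_t (`|sval F t - sval G t| `^ p)%:E =
  (mean (fun t => `|f t - g t| `^ p))%:E)%E.
Proof.
move=> df dg Ff Gg.
have dfg : dyadic n (fun t => `|f t - g t| `^ p).
  exact: (dyadic_comp2 (fun x y => `|x - y| `^ p)).
rewrite -(mean_fin dfg); last by move=> t; exact: powR_ge0.
apply: ge0_ae_eq_integral => //=.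
- apply/measurable_EFinP.
  apply: (measurableT_comp (measurable_powR p)) => //.
  apply: (measurableT_comp (@normr_measurable R setT)) => //.
  apply: measurable_funB.
  - exact: (@measurable_funPT _ _ _ _ (repr (sval F))).
  - exact: (@measurable_funPT _ _ _ _ (repr (sval G))).
- apply/measurable_EFinP; exact: (measurable_dyadic dfg).
- have FF := @ae_filter_ringOfSetsType _ _ R (lebesgue01 R).
  apply: (@filterS2 _ _ FF _ _ _ _ Ff Gg) => t /= Ft Gt _.
  by rewrite (Ft I) (Gt I).
Qed.

Lemma Lp_dist_represents p (F G : @Lp_space R p) n f g :
  dyadic n f -> dyadic n g -> represents F f -> represents G g ->
  Lp_dist F G = dist_of_power p (mean (fun t => `|f t - g t| `^ p)).
Proof.
move=> df dg Ff Gg; rewrite /Lp_dist /dist_of_power.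
have E := integral_represents df dg Ff Gg.
case: ifPn => p1; first by rewrite E.
rewrite unlock /Lnorm.
rewrite (_ : (\int[lebesgue01 R]_x _)%E = (mean (fun t => `|f t - g t| `^ p))%:E); last first.
  by rewrite -E; apply: eq_integral => t _; rewrite /= ?poweR_EFin.
by rewrite poweR_EFin.
Qed.

Lemma Lp_represents p n f : 0 < p -> dyadic n f ->
  exists F : @Lp_space R p, represents F f.
Proof.
move=> p0 df.
have mf := measurable_dyadic df.
pose f1 : {mfun measurableTypeR R >-> measurableTypeR R} :=
    @mfun_Sub _ _ (measurableTypeR R) (measurableTypeR R) f (mem_set mf).
pose F : {mfun_ (lebesgue01 R), measurableTypeR R >-> measurableTypeR R} :=
  \pi_({mfun_ (lebesgue01 R), measurableTypeR R >-> measurableTypeR R})%qT f1.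
have Ff : (F : R -> R) = f %[ae lebesgue01 R].
  have : (repr F = f1 %[mod {mfun_ (lebesgue01 R), measurableTypeR R >-> measurableTypeR R}])%qT.
    by rewrite reprK.
  move/eqP; rewrite eqmodE => /asboolP; exact.
suff fin : finite_norm (lebesgue01 R) p%:E F by exists (exist _ F fin).
have dfp : dyadic n (fun t => `|f t| `^ p) by exact: (dyadic_comp (fun x => `|x| `^ p)).
rewrite /finite_norm unlock /Lnorm poweR_lty//.
rewrite (_ : (\int[lebesgue01 R]_x _)%E = (mean (fun t => `|f t| `^ p))%:E) ?ltry//.
rewrite -(mean_fin dfp); last by move=> t; exact: powR_ge0.
apply: ge0_ae_eq_integral => //=.
- apply/measurable_EFinP.
  apply: (measurableT_comp (measurable_powR p)) => //.
  apply: (measurableT_comp (@normr_measurable R setT)) => //.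
  exact: (@measurable_funPT _ _ _ _ (repr F)).
- apply/measurable_EFinP; exact: (measurable_dyadic dfp).
- have FF := @ae_filter_ringOfSetsType _ _ R (lebesgue01 R).
  apply: (@filterS _ _ FF _ _ _ Ff) => t /= Ft _; by rewrite (Ft I).
Qed.

End Mean.
(** * The metric of l_q *)

Section SequenceSpace.
Context {R : realType}.
Implicit Types (q : R).

(** With this exponent e, both definitions of d_q read (sum of q-th powers)^(1/e),
    and the quasi-triangle constant is 2^(e-1): the cases q <= 1 and q >= 1 need no
    separate treatment from here on. *)
Definition norm_exp q : R := Num.max 1 q.

Lemma norm_exp_ge1 q : 1 <= norm_exp q.
Proof. by rewrite /norm_exp le_max lexx. Qed.

Lemma norm_exp_gt0 q : 0 < norm_exp q.
Proof. exact: lt_le_trans (norm_exp_ge1 q). Qed.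

Lemma dist_of_powerE q s : 0 <= s -> dist_of_power q s = s `^ (norm_exp q)^-1.
Proof.
rewrite /dist_of_power /norm_exp => s0; case: (leP q 1) => q1.
  by rewrite invr1 powRr1.
by [].
Qed.

Lemma quasi_cstE q : quasi_cst q = 2 `^ (norm_exp q - 1).
Proof.
rewrite /quasi_cst /norm_exp; case: (leP 1 q) => q1.
- apply/max_idPr; have := @ler_powR R 2 _ 0 (q - 1) _.
  by rewrite powRr0; apply; rewrite ?ler1n// subr_ge0.
- rewrite subrr powRr0; apply/max_idPl; have := @ler_powR R 2 _ (q - 1) 0 _.
  by rewrite powRr0; apply; rewrite ?ler1n// subr_le0 ltW.
Qed.

Lemma powR_norm_expK q s : 0 <= s -> (s `^ (norm_exp q)^-1) `^ norm_exp q = s.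
Proof. by move=> s0; rewrite -powRrM mulVf ?powRr1// gt_eqF// norm_exp_gt0. Qed.

Lemma ler_dist_of_power q r s : 0 <= r -> r <= s -> dist_of_power q r <= dist_of_power q s.
Proof.
move=> r0 rs; have s0 := le_trans r0 rs; rewrite !dist_of_powerE//.
by apply: ge0_ler_powR; rewrite ?nnegrE// invr_ge0 ltW ?norm_exp_gt0.
Qed.

Lemma dist_of_power_ge0 q s : 0 <= s -> 0 <= dist_of_power q s.
Proof. by move=> s0; rewrite dist_of_powerE// powR_ge0. Qed.

Lemma power_sum_nneseries q (z : nat -> R) N :
  ((power_sum q z N)%:E <= \sum_(n <oo) (`|z n| `^ q)%:E)%E.
Proof.
rewrite /power_sum -(big_mkord xpredT (fun i => `|z i| `^ q)) -sumEFin.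
by apply: nneseries_lim_ge => n _ _; rewrite lee_fin powR_ge0.
Qed.

Lemma nneseries_power_sum q (z : nat -> R) M : power_sum_bounded q z M ->
  (\sum_(n <oo) (`|z n| `^ q)%:E <= M%:E)%E.
Proof.
move=> zM; apply: lime_le.
  by apply: is_cvg_nneseries => n _ _; rewrite lee_fin powR_ge0.
apply: nearW => N; rewrite sumEFin lee_fin.
by rewrite (big_mkord xpredT (fun i => `|z i| `^ q)); exact: zM.
Qed.

Lemma finite_norm_power_sum q (z : nat -> R) : 0 < q ->
  finite_norm (@counting nat R) q%:E z -> exists M, power_sum_bounded q z M.
Proof.
move=> q0; rewrite /finite_norm Lnorm_counting// => fin.
have {fin} : (\sum_(n <oo) (`|z n| `^ q)%:E < +oo)%E.
  rewrite ltey; apply/eqP => E; move: fin.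
  rewrite (_ : (\sum_(k <oo) _)%E = +oo%E) ?poweRyr ?ltxx//.
  by rewrite invr_eq0 gt_eqF.
have S0 : (0 <= \sum_(n <oo) (`|z n| `^ q)%:E)%E.
  by apply: nneseries_ge0 => n _ _; rewrite lee_fin powR_ge0.
move=> fin; exists (fine (\sum_(n <oo) (`|z n| `^ q)%:E)%E) => N.
by rewrite -lee_fin fineK ?power_sum_nneseries// ge0_fin_numE.
Qed.

Lemma lp_dist_power_sum q (x y : @lp_space R q) : 0 < q ->
  exists S, [/\ 0 <= S, lp_dist x y = dist_of_power q S,
    power_sum_bounded q (fun i => sval x i - sval y i) S &
    forall M, power_sum_bounded q (fun i => sval x i - sval y i) M -> S <= M].
Proof.
move=> q0; have [Mx xM] := finite_norm_power_sum q0 (svalP x).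
have [My yM] := finite_norm_power_sum q0 (svalP y).
set z := fun i => sval x i - sval y i.
have zM : power_sum_bounded q z (quasi_cst q * (Mx + My)).
  move=> N; apply: le_trans (power_sumB _ _ N q0) _.
  by rewrite ler_pM2l ?quasi_cst_gt0// lerD.
have S0 : (0 <= \sum_(n <oo) (`|z n| `^ q)%:E)%E.
  by apply: nneseries_ge0 => n _ _; rewrite lee_fin powR_ge0.
have Sfin : (\sum_(n <oo) (`|z n| `^ q)%:E)%E \is a fin_num.
  by rewrite ge0_fin_numE//; apply: le_lt_trans (nneseries_power_sum zM) _; rewrite ltry.
exists (fine (\sum_(n <oo) (`|z n| `^ q)%:E)%E); split.
- exact: fine_ge0.
- rewrite /lp_dist /dist_of_power; case: ifPn => // q1.
  rewrite Lnorm_counting//.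
  rewrite (_ : (\sum_(k <oo) _)%E = (\sum_(n <oo) (`|z n| `^ q)%:E)%E)//.
  by rewrite -(fineK Sfin) poweR_EFin.
- by move=> N; rewrite -lee_fin fineK// power_sum_nneseries.
- by move=> M /nneseries_power_sum; rewrite -(fineK Sfin) lee_fin.
Qed.

Lemma lp_dist_le q (x y : @lp_space R q) M : 0 < q ->
  power_sum_bounded q (fun i => sval x i - sval y i) M -> lp_dist x y <= dist_of_power q M.
Proof.
move=> q0 xyM; have [S [S0 -> _ Smin]] := lp_dist_power_sum x y q0.
by apply: ler_dist_of_power => //; exact: Smin.
Qed.

Lemma power_sum_bounded_lp_dist q (x y : @lp_space R q) : 0 < q ->
  0 <= lp_dist x y /\
  power_sum_bounded q (fun i => sval x i - sval y i) (lp_dist x y `^ norm_exp q).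
Proof.
move=> q0; have [S [S0 -> SS _]] := lp_dist_power_sum x y q0.
by rewrite dist_of_power_ge0// dist_of_powerE// powR_norm_expK.
Qed.

Lemma powR_1D_le (s d : R) : 1 <= s -> 0 <= d -> d <= 1 ->
  (1 + d) `^ s <= 1 + 2 `^ s * d.
Proof.
move=> s1 d0 d1.
have H : (d * 2 + (1 - d) * 1) `^ s <= d * 2 `^ s + (1 - d) * 1 `^ s.
  by apply: (convex_powR s1 (Itv01 d0 d1)) => //=;
    rewrite ?inE/= ?in_itv/= ?andbT.
move: H; rewrite powR1 (_ : d * 2 + _ = 1 + d); last by ring.
lra.
Qed.

(** In terms of sums of q-th powers, a d-approximate midpoint satisfies
    S(z - x) <= ((1+d)/2)^e S(x - y). As 2 c 2^-e = 1, this is the hypothesis of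
    [midpoints_close], with (1+d)^e <= 1 + 2^e d as relative error. *)
Lemma lp_midpoints_close q (x y : @lp_space R q) (Z : nat -> @lp_space R q) (d : R) :
  0 < q -> 0 < d -> d <= 1 -> 0 < lp_dist x y ->
  (forall n, lp_dist (Z n) x <= (1 + d) / 2 * lp_dist x y) ->
  (forall n, lp_dist (Z n) y <= (1 + d) / 2 * lp_dist x y) ->
  exists n m, (n < m)%N /\
    lp_dist (Z n) (Z m) <= (5 * (2 `^ norm_exp q * d)) `^ (norm_exp q)^-1 * lp_dist x y.
Proof.
move=> q0 d0 d1; have [S [S0 -> xyS Smin]] := lp_dist_power_sum x y q0.
rewrite dist_of_powerE// => rS0 Zx Zy.
have Sp : 0 < S.
  rewrite lt_neqAle S0 andbT; apply: contraTneq rS0 => <-.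
  by rewrite powR0 ?ltxx// invr_eq0 gt_eqF// norm_exp_gt0.
have h2 : 0 <= (1 + d) / 2 by lra.
have h1 : 0 <= 1 + d by lra.
have e0 := norm_exp_gt0 q; set e := norm_exp q in e0 *.
have bnd (u v : @lp_space R q) : lp_dist u v <= (1 + d) / 2 * S `^ e^-1 ->
    power_sum_bounded q (fun i => sval u i - sval v i) (((1 + d) / 2) `^ e * S).
  move=> uv N; have [uv0 uvb] := power_sum_bounded_lp_dist u v q0.
  apply: (le_trans (uvb N)); rewrite -[X in _ * X](powR_norm_expK q)// -powRM ?powR_ge0//.
  by apply: ge0_ler_powR; rewrite ?nnegrE ?mulr_ge0 ?powR_ge0// ltW.
have c0 : 0 < 2 `^ e * d by rewrite mulr_gt0// powR_gt0.
have DS : quasi_cst q * (2 * (((1 + d) / 2) `^ e * S)) <= (1 + 2 `^ e * d) * S.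
  rewrite !mulrA ler_pM2r// powRM ?invr_ge0//.
  rewrite quasi_cstE -/e powRB ?pnatr_eq0 ?implybT// powRr1//.
  rewrite divfK ?pnatr_eq0// mulrCA -powRM// divff ?pnatr_eq0// powR1 mulr1.
  by apply: powR_1D_le; rewrite ?norm_exp_ge1// ltW.
have [n [m [nm H]]] := midpoints_close q0 c0 Sp xyS Smin DS
  (fun n => bnd _ _ (Zx n)) (fun n => bnd _ _ (Zy n)).
exists n, m; split => //; apply: (le_trans (lp_dist_le q0 H)).
have H1 : 0 <= 5 * (2 `^ e * d) by rewrite mulr_ge0// ltW.
by rewrite dist_of_powerE ?(powRM _ H1 S0)//; exact: mulr_ge0.
Qed.

End SequenceSpace.
(** * Approximate midpoints under an embedding *)

Section Midpoints.
Context {R : realType}.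
Implicit Types (p q : R).

(** Some pair comes within a factor 1 - d of the best Lipschitz constant. The
    conclusion is written without division, so that it also covers pairs at
    distance 0. *)
Lemma near_extremal (X Y : Type) (dX : X -> X -> R) (dY : Y -> Y -> R)
    (f : X -> Y) (B d : R) (x0 y0 : X) : 0 < d -> d < 1 ->
  (forall x y, 0 <= dX x y) -> (forall x y, dY (f x) (f y) <= B * dX x y) ->
  0 < dX x0 y0 -> 0 < dY (f x0) (f y0) ->
  exists x y, [/\ 0 < dX x y, 0 < dY (f x) (f y) & forall u v,
    (1 - d) * dY (f u) (f v) * dX x y <= dY (f x) (f y) * dX u v].
Proof.
move=> d0 d1 dX0 fB dX1 dY1.
pose E := [set r | exists x y, 0 < dX x y /\ r = dY (f x) (f y) / dX x y].
have E0 : E (dY (f x0) (f y0) / dX x0 y0) by exists x0, y0.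
have hE : has_sup E.
  split; first by eexists; exact: E0.
  by exists B => _ [x [y [dxy ->]]]; rewrite ler_pdivrMr.
have sE : 0 < sup E.
  by apply: lt_le_trans (sup_upper_bound hE E0); exact: divr_gt0.
have [_ [x [y [dxy ->]]]] := sup_adherent (mulr_gt0 d0 sE) hE.
rewrite -{1}(mul1r (sup E)) -mulrBl => h1.
have h2 : 0 < dY (f x) (f y) / dX x y.
  by apply: lt_trans h1; rewrite mulr_gt0// subr_gt0.
exists x, y; split => //; first by move: h2; rewrite pmulr_lgt0// invr_gt0.
move=> u v; rewrite -ler_pdivlMr// mulrAC.
have [uv0|uvn] := eqVneq (dX u v) 0.
  have := fB u v; rewrite uv0 !mulr0 => fuv.
  by apply: mulr_ge0_le0; rewrite // subr_ge0 ltW.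
have uvp : 0 < dX u v by rewrite lt_neqAle eq_sym uvn dX0.
have := sup_upper_bound hE; move=> /(_ (dY (f u) (f v) / dX u v)) H.
have {}H : dY (f u) (f v) / dX u v <= sup E by apply: H; exists u, v.
rewrite -ler_pdivrMr// -mulrA; apply: le_trans (ltW h1).
by rewrite ler_pM2l// subr_gt0.
Qed.

(** At a nearly extremal pair a Lipschitz map sends approximate midpoints to
    approximate midpoints, and in l_q these cannot be uniformly separated by more
    than d^(1/e). *)
Lemma no_embedding_midpoints q (X : Type) (dX : X -> X -> R)
    (f : X -> @lp_space R q) (A B d eta : R) (x0 y0 : X) :
  0 < q -> 0 < A -> 0 < B -> 0 < d -> 4 * d <= 1 ->
  (forall x y, 0 <= dX x y) -> 0 < dX x0 y0 ->
  (forall x y, A^-1 * dX x y <= lp_dist (f x) (f y) <= B * dX x y) ->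
  (forall x y, 0 < dX x y -> exists Z : nat -> X,
    [/\ forall n, dX (Z n) x <= (1 + d) / 2 * dX x y,
        forall n, dX (Z n) y <= (1 + d) / 2 * dX x y &
        forall n m, (n < m)%N -> eta * dX x y <= dX (Z n) (Z m)]) ->
  eta <= A * B * (20 * 2 `^ norm_exp q * d) `^ (norm_exp q)^-1.
Proof.
move=> q0 A0 B0 d0 d4 dX0 xy0 fAB mid.
have fB x y : lp_dist (f x) (f y) <= B * dX x y by case/andP: (fAB x y).
have fA x y : A^-1 * dX x y <= lp_dist (f x) (f y) by case/andP: (fAB x y).
have d1 : d < 1 by lra.
have fxy0 : 0 < lp_dist (f x0) (f y0).
  by apply: lt_le_trans (fA _ _); rewrite mulr_gt0 ?invr_gt0.
have [x [y [xy fxy ext]]] := near_extremal d0 d1 dX0 fB xy0 fxy0.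
have [Z [Zx Zy Zs]] := mid _ _ xy.
have step u v : dX u v <= (1 + d) / 2 * dX x y ->
    lp_dist (f u) (f v) <= (1 + 4 * d) / 2 * lp_dist (f x) (f y).
  move=> uv; have {}uv : lp_dist (f x) (f y) * dX u v <=
      lp_dist (f x) (f y) * ((1 + d) / 2 * dX x y) by rewrite ler_pM2l.
  have := le_trans (ext u v) uv.
  rewrite [leRHS]mulrA ler_pM2r// => H.
  have d1' : 0 < 1 - d by lra.
  (* (1 + d) / (1 - d) <= 1 + 4 d, because 2 d <= 1 *)
  rewrite -(ler_pM2l d1'); apply: (le_trans H).
  rewrite mulrC [leRHS]mulrA ler_pM2r//.
  have : 0 <= d * (1 - 2 * d) by rewrite mulr_ge0//; lra.
  lra.
have d40 : 0 < 4 * d by lra.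
have [n [m [nm close]]] := lp_midpoints_close q0 d40 d4 fxy
  (fun n => step _ _ (Zx n)) (fun n => step _ _ (Zy n)).
have := le_trans (fA _ _) close.
rewrite (_ : 5 * _ = 20 * 2 `^ norm_exp q * d); last by ring.
set K := _ `^ (norm_exp q)^-1; have K0 : 0 <= K by exact: powR_ge0.
move=> H; have H1 := Zs _ _ nm.
have H2 : A^-1 * (eta * dX x y) <= K * (B * dX x y).
  apply: le_trans (le_trans _ H) _; last exact: ler_wpM2l.
  by rewrite ler_pM2l// invr_gt0.
move: H2; rewrite (mulrA K) (mulrA A^-1) ler_pM2r// mulrC ler_pdivrMr//.
by move/le_trans; apply; rewrite (_ : K * B * A = A * B * K)//; ring.
Qed.

Definition dyadic_fun : Type := {f : R -> R | exists n, dyadic n f}.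

(** The distance d_p of the classes of two dyadic step functions. *)
Definition dyadic_dist p (f g : dyadic_fun) : R :=
  dist_of_power p (mean (fun t => `|sval f t - sval g t| `^ p)).

Lemma dyadic_common (f g : dyadic_fun) :
  exists n, dyadic n (sval f) /\ dyadic n (sval g).
Proof.
case: f g => [f [n fn]] [g [m gm]]; exists (maxn n m) => /=.
by split; [exact: dyadic_le (leq_maxl _ _) fn|exact: dyadic_le (leq_maxr _ _) gm].
Qed.

Lemma embeds_dyadic p q : 0 < p ->
  lipschitz_embeds (@Lp_dist R p) (@lp_dist R q) ->
  exists (f : dyadic_fun -> @lp_space R q) (A B : R), [/\ 0 < A, 0 < B &
    forall x y, A^-1 * dyadic_dist p x y <= lp_dist (f x) (f y)
                <= B * dyadic_dist p x y].
Proof.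
move=> p0 [f [A [B [_ A0 B0 fAB]]]].
have /choice[E HE] : forall x : dyadic_fun, exists F : @Lp_space R p,
    represents F (sval x).
  by case=> g [n gn]; exact: Lp_represents gn.
exists (f \o E), A, B; split => // x y.
have [n [xn yn]] := dyadic_common x y.
by rewrite /dyadic_dist -(Lp_dist_represents xn yn (HE x) (HE y)).
Qed.

Lemma dyadic_dist_ge0 p x y : 0 <= dyadic_dist p x y.
Proof.
have [n [xn yn]] := dyadic_common x y.
apply: dist_of_power_ge0; apply: (@mean_ge0 _ n); last by move=> t; exact: powR_ge0.
exact: (dyadic_comp2 (fun a b => `|a - b| `^ p)).
Qed.

Lemma rademacherP n (t : R) : rademacher n t = 1 \/ rademacher n t = -1.
Proof. by rewrite /rademacher; case: odd; [right; rewrite expr1|left; rewrite expr0]. Qed.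

(** The points y + h (1 + e r_n) / 2 with h = x - y and n at least a level
    common to x and y.
    Independence of r_n and h gives the first two equalities. For the third one,
    |r_n - r_m| takes the values 0 and 2 with probability 1/2 each, whatever the
    value of r_n. *)
Lemma dyadic_fun_midpoints p (e : R) (x y : dyadic_fun) : 0 < p -> 0 <= e -> e <= 1 ->
  exists Z : nat -> dyadic_fun,
  let M := mean (fun t => `|sval x t - sval y t| `^ p) in
  let kappa := (((1 + e) / 2) `^ p + ((1 - e) / 2) `^ p) / 2 in
    [/\ forall n, mean (fun t => `|sval (Z n) t - sval x t| `^ p) = kappa * M,
        forall n, mean (fun t => `|sval (Z n) t - sval y t| `^ p) = kappa * M &
        forall n m, (n < m)%N ->
         mean (fun t => `|sval (Z n) t - sval (Z m) t| `^ p) = e `^ p / 2 * M].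
Proof.
move=> p0 e0 e1; have [N [xN yN]] := dyadic_common x y.
pose h t := sval x t - sval y t.
have hN : dyadic N h by exact: (dyadic_comp2 (fun a b => a - b)).
pose z n t := sval y t + h t * (1 + e * rademacher (N + n) t) / 2.
have zd n : exists m, dyadic m (z n).
  exists (N + n).+1.
  have rd : dyadic (N + n).+1 (fun t => (1 + e * rademacher (N + n) t) / 2).
    exact: (dyadic_comp (fun a => (1 + e * a) / 2) (dyadic_rademacher _)).
  have hd := dyadic_comp2 (fun a b => a * b) (dyadic_le (leqW (leq_addr n N)) hN) rd.
  have := dyadic_comp2 (fun a b => a + b) (dyadic_le (leqW (leq_addr n N)) yN) hd.
  by congr (dyadic _ _); apply/funext => t; rewrite /z; ring.
exists (fun n => exist _ (z n) (zd n)) => M kappa.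
have hp0 t : 0 <= `|h t| `^ p by exact: powR_ge0.
have hpd n : (N <= n)%N -> dyadic n (fun t => `|h t| `^ p).
  by move=> Nn; apply: dyadic_le Nn _; exact: (dyadic_comp (fun a => `|a| `^ p)).
have main n (s : R) : s = 1 \/ s = -1 ->
    mean (fun t => `|h t * (1 + s * e * rademacher (N + n) t) / 2| `^ p) = kappa * M.
  move=> s1.
  have E (c : R) : 0 <= c -> (fun t => `|h t * c| `^ p) = fun t => c `^ p * `|h t| `^ p.
    by move=> c0; apply/funext => t; rewrite normrM (ger0_norm c0) powRM// mulrC.
  have E2 (c : R) : c = 1 \/ c = -1 -> 0 <= (1 + s * e * c) / 2.
    by move=> c1; case: s1 => ->; case: c1 => ->; lra.
  have dP (c : R) : c = 1 \/ c = -1 ->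
      dyadic (N + n) (fun t => `|h t * (1 + s * e * c) / 2| `^ p).
    move=> c1; have := dyadic_comp (fun a => `|a * (1 + s * e * c) / 2| `^ p)
      (dyadic_le (leq_addr n N) hN); exact.
  rewrite (@mean_rademacher _ (N + n) (fun t c => `|h t * (1 + s * e * c) / 2| `^ p)); last first.
  - by move=> t; exact: powR_ge0.
  - by move=> t; exact: powR_ge0.
  - by apply: dP; right.
  - by apply: dP; left.
  have Emean (c : R) : c = 1 \/ c = -1 ->
     mean (fun t => `|h t * (1 + s * e * c) / 2| `^ p) =
     ((1 + s * e * c) / 2) `^ p * M.
    move=> c1; under eq_fun do rewrite -mulrA.
    rewrite E; last exact: E2.
    by rewrite (@meanZ _ N)//; [exact: hpd|exact: powR_ge0].
  rewrite !Emean; [|by right|by left].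
  by rewrite /kappa; case: s1 => ->; rewrite !(mul1r, mulr1, mulN1r, mulrN1, opprK); ring.
split => /=.
- move=> n; rewrite -(main n (-1)); last by right.
  congr mean; apply/funext => t; rewrite -normrN; congr (`| _ | `^ p).
  by rewrite /z /h; field.
- move=> n; rewrite -(main n 1); last by left.
  congr mean; apply/funext => t; congr (`| _ | `^ p).
  by rewrite /z; field.
- move=> n m nm.
  have -> : (fun t => `|z n t - z m t| `^ p) =
      (fun t => `|h t * (e * (rademacher (N + n) t - rademacher (N + m) t) / 2)| `^ p).
    by apply/funext => t; congr (`| _ | `^ p); rewrite /z; field.
  have Nnm : (N + n < N + m)%N by rewrite ltn_add2l.
  have dP c : dyadic (N + m) (fun t => `|h t * (e * (rademacher (N + n) t - c) / 2)| `^ p).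
    exact: (dyadic_comp2 (fun a b => `|a * (e * (b - c) / 2)| `^ p)
      (dyadic_le (leq_addr _ _) hN) (dyadic_le Nnm (dyadic_rademacher _))).
  rewrite (@mean_rademacher _ (N + m)
    (fun t c => `|h t * (e * (rademacher (N + n) t - c) / 2)| `^ p))//; try (by move=> t; exact: powR_ge0).
  rewrite -(@meanD _ (N + m))//; try (by move=> t; exact: powR_ge0).
  have -> : (fun t => `|h t * (e * (rademacher (N + n) t - 1) / 2)| `^ p +
       `|h t * (e * (rademacher (N + n) t - -1) / 2)| `^ p) =
       fun t => e `^ p * `|h t| `^ p.
    apply/funext => t.
    case: (rademacherP (N + n) t) => ->; rewrite ?opprK ?subrr ?addNr !(mulr0, mul0r) normr0.
    - rewrite powR0 ?gt_eqF// add0r (_ : e * (1 + 1) / 2 = e); last by field.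
      by rewrite normrM (ger0_norm e0) powRM// mulrC.
    - rewrite powR0 ?gt_eqF// addr0 (_ : e * (-1 - 1) / 2 = - e); last by field.
      by rewrite normrM normrN (ger0_norm e0) powRM// mulrC.
  rewrite (@meanZ _ N)//; [|exact: hpd|exact: powR_ge0].
  rewrite /M -/h; ring.
Qed.

End Midpoints.
(** * No embedding when p <= 1 or q < 2 *)

Section NoEmbedding.
Context {R : realType}.
Implicit Types (p q : R).

Lemma powR_small_scale (a b c C : R) : a < b -> 0 < c -> 0 < C ->
  exists d, [/\ 0 < d, 4 * d <= 1 & C * d `^ b < c * d `^ a].
Proof.
move=> ab c0 C0; pose eta := c / (2 * C).
have eta0 : 0 < eta by rewrite divr_gt0// mulr_gt0.
have ba0 : 0 < b - a by rewrite subr_gt0.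
pose d := Num.min (4^-1) (eta `^ (b - a)^-1).
have d0 : 0 < d by rewrite lt_min invr_gt0 ltr0n powR_gt0.
have dle : d <= eta `^ (b - a)^-1 by rewrite ge_min lexx orbT.
exists d; split => //.
  have : d <= 4^-1 by rewrite ge_min lexx.
  lra.
have -> : d `^ b = d `^ (b - a) * d `^ a.
  by rewrite -powRD ?subrK// (gt_eqF d0) implybT.
rewrite mulrA ltr_pM2r ?powR_gt0//.
apply: (@le_lt_trans _ _ (C * eta)); last first.
  by rewrite /eta invfM mulrCA mulrA mulrACA divff ?gt_eqF//; lra.
rewrite ler_pM2l//.
have -> : eta = (eta `^ (b - a)^-1) `^ (b - a).
  by rewrite -powRrM mulVf ?gt_eqF// powRr1// ltW.
by apply: ge0_ler_powR; rewrite ?nnegrE ?powR_ge0// ltW.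
Qed.

Lemma powR_large_scale (a b c C : R) : a < b -> 0 < c -> 0 < C ->
  exists k : nat, C * k.+1%:R `^ a < c * k.+1%:R `^ b.
Proof.
move=> ab c0 C0; have ba0 : 0 < b - a by rewrite subr_gt0.
pose k := Num.truncn ((C / c) `^ (b - a)^-1).
exists k; have k0 : 0 < k.+1%:R :> R by rewrite ltr0n.
have -> : k.+1%:R `^ b = k.+1%:R `^ (b - a) * k.+1%:R `^ a :> R.
  by rewrite -powRD ?subrK// (gt_eqF k0) implybT.
rewrite mulrA ltr_pM2r ?powR_gt0// mulrC -ltr_pdivrMr//.
have -> : C / c = ((C / c) `^ (b - a)^-1) `^ (b - a).
  by rewrite -powRrM mulVf ?gt_eqF// powRr1// divr_ge0 ?ltW.
apply: gt0_ltr_powR; rewrite ?nnegrE ?powR_ge0//.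
exact: truncnS_gt.
Qed.

(** The terms of first order in e cancel: 1 + s <= exp s bounds the sum by
    exp(pe) + exp(-pe) <= 1/(1 - pe) + 1/(1 + pe) = 2/(1 - p^2 e^2). *)
Lemma powR_mean_le p (e : R) : 0 < p -> 0 <= e -> e <= 1 -> p ^+ 2 * e ^+ 2 <= 2^-1 ->
  ((1 + e) `^ p + (1 - e) `^ p) / 2 <= 1 + 2 * (p ^+ 2 * e ^+ 2).
Proof.
move=> p0 e0 e1; rewrite -exprMn; set x := p * e => x2.
have key (s : R) : 0 <= 1 + s -> (1 + s) `^ p <= expR (p * s).
  move=> s0; rewrite mulrC expRM; apply: ge0_ler_powR; rewrite ?nnegrE ?expR_ge0//.
    exact: ltW.
  exact: expR_ge1Dx.
have x1 : x ^+ 2 < 1 by apply: le_lt_trans x2 _; lra.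
have x0 : 0 <= x by rewrite mulr_ge0// ltW.
have xl1 : x < 1.
  by rewrite ltNge; apply/negP => h; have := mulr_ege1 h h; rewrite -expr2; lra.
have h1 : (1 + e) `^ p <= (1 - x)^-1.
  apply: (le_trans (key _ _)); first lra.
  rewrite -[expR _]invrK -expRN lef_pV2 ?posrE ?expR_gt0//; last lra.
  exact: expR_ge1Dx.
have h2 : (1 - e) `^ p <= (1 + x)^-1.
  apply: (le_trans (key _ _)); first lra.
  rewrite mulrN -[expR _]invrK -expRN opprK lef_pV2 ?posrE ?expR_gt0//; last lra.
  exact: expR_ge1Dx.
apply: (@le_trans _ _ (((1 - x)^-1 + (1 + x)^-1) / 2)).
  by rewrite ler_pM2r// lerD.
have a1 : 1 - x != 0 by apply/eqP; lra.
have a2 : 1 + x != 0 by apply/eqP; lra.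
have a3 : 0 < 1 - x ^+ 2 by lra.
have -> : ((1 - x)^-1 + (1 + x)^-1) / 2 = (1 - x ^+ 2)^-1.
  by rewrite (_ : 1 - x ^+ 2 = (1 - x) * (1 + x)); [field; rewrite a1 a2|ring].
rewrite -div1r ler_pdivrMr//.
have : 0 <= x ^+ 2 * (1 - 2 * x ^+ 2) by rewrite mulr_ge0 ?sqr_ge0//; lra.
lra.
Qed.

Lemma mean_dist_ge0 p (x y : @dyadic_fun R) :
  0 <= mean (fun t => `|sval x t - sval y t| `^ p).
Proof.
have [n [xn yn]] := dyadic_common x y.
apply: (@mean_ge0 _ n); last by move=> t; exact: powR_ge0.
exact: (dyadic_comp2 (fun a b => `|a - b| `^ p)).
Qed.

Definition zero_fun : @dyadic_fun R := exist _ _ (ex_intro _ 0%N (dyadic_cst 0 0)).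
Definition one_fun : @dyadic_fun R := exist _ _ (ex_intro _ 0%N (dyadic_cst 0 1)).

Lemma dyadic_dist01 p : 0 < dyadic_dist p zero_fun one_fun.
Proof.
rewrite /dyadic_dist dist_of_powerE ?mean_dist_ge0//.
by rewrite /= sub0r normrN1 powR1 mean_cst// powR1.
Qed.

Lemma no_embedding_le1 p q : 0 < p -> 0 < q -> p <= 1 ->
  ~ lipschitz_embeds (@Lp_dist R p) (@lp_dist R q).
Proof.
move=> p0 q0 p1 /(embeds_dyadic p0)[f [A [B [A0 B0 fAB]]]].
pose K : R := 20 * 2 `^ norm_exp q.
have K0 : 0 < K by rewrite mulr_gt0// powR_gt0.
have th0 : 0 < (norm_exp q)^-1 by rewrite invr_gt0 norm_exp_gt0.
have C0 : 0 < A * B * K `^ (norm_exp q)^-1 by rewrite !mulr_gt0// powR_gt0.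
have half0 : 0 < 2^-1 :> R by rewrite invr_gt0.
have [d [d0 d4]] := powR_small_scale th0 half0 C0.
rewrite powRr0 mulr1 -mulrA -powRM; [|exact: ltW|exact: ltW].
move=> H; suff : 2^-1 <= A * B * (K * d) `^ (norm_exp q)^-1 by rewrite leNgt H.
apply: (no_embedding_midpoints q0 A0 B0 d0 d4 (@dyadic_dist_ge0 _ p)
  (dyadic_dist01 p) fAB) => x y _.
have [Z /= [Zx Zy Zs]] := dyadic_fun_midpoints x y p0 ler01 (lexx 1).
have M0 := mean_dist_ge0 p x y.
rewrite /dyadic_dist /dist_of_power p1.
move: Zx Zy Zs M0; set M := mean _.
rewrite (_ : (1 + 1) / 2 = 1); last by field.
rewrite subrr mul0r powR1 powR0 ?gt_eqF// addr0 => Zx Zy Zs M0.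
have dM : 0 <= d * M by rewrite mulr_ge0// ltW.
exists Z; split => [n|n|n m nm]; rewrite ?Zx ?Zy ?Zs//; lra.
Qed.

(** Here e^2 = d / (2 p^2), which makes the bound of [powR_mean_le] equal to
    1 + d; the separation is then a multiple of d^(1/2). *)
Lemma no_embedding_lt2 p q : 1 < p -> 0 < q -> q < 2 ->
  ~ lipschitz_embeds (@Lp_dist R p) (@lp_dist R q).
Proof.
move=> p1 q0 q2; have p0 : 0 < p by lra.
move=> /(embeds_dyadic p0)[f [A [B [A0 B0 fAB]]]].
pose K : R := 20 * 2 `^ norm_exp q.
have K0 : 0 < K by rewrite mulr_gt0// powR_gt0.
have th0 : 2^-1 < (norm_exp q)^-1.
  by rewrite ltf_pV2 ?posrE ?norm_exp_gt0// /norm_exp gt_max q2 andbT ltr1n.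
have C0 : 0 < A * B * K `^ (norm_exp q)^-1 by rewrite !mulr_gt0// powR_gt0.
pose c := 2^-1 `^ p^-1 * (2 * p ^+ 2)^-1 `^ 2^-1 : R.
have pp0 : 0 < 2 * p ^+ 2 by rewrite mulr_gt0// exprn_gt0.
have c0 : 0 < c by rewrite mulr_gt0// powR_gt0// invr_gt0.
have [d [d0 d4]] := powR_small_scale th0 c0 C0.
move=> H0; pose e := ((2 * p ^+ 2)^-1 * d) `^ 2^-1.
have H : A * B * (K * d) `^ (norm_exp q)^-1 < 2^-1 `^ p^-1 * e.
  have ip0 : 0 <= (2 * p ^+ 2)^-1 by rewrite invr_ge0 ltW.
  move: H0; rewrite /c /e (powRM _ (ltW K0) (ltW d0)) (powRM _ ip0 (ltW d0)).
  by rewrite !mulrA.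
have e0 : 0 <= e by exact: powR_ge0.
have e2 : e ^+ 2 = (2 * p ^+ 2)^-1 * d.
  rewrite -powR_mulrn// /e -powRrM mulVf ?pnatr_eq0// powRr1//.
  by rewrite mulr_ge0 ?invr_ge0// ltW.
have pe : 2 * (p ^+ 2 * e ^+ 2) = d by rewrite e2 mulrA mulVKf// gt_eqF.
have e1 : e <= 1.
  rewrite leNgt; apply/negP => e1.
  have : 1 <= p ^+ 2 * e ^+ 2.
    by rewrite -exprMn exprn_ege1// mulr_ege1// ltW.
  lra.
suff : 2^-1 `^ p^-1 * e <= A * B * (K * d) `^ (norm_exp q)^-1 by rewrite leNgt H.
apply: (no_embedding_midpoints q0 A0 B0 d0 d4 (@dyadic_dist_ge0 _ p)
  (dyadic_dist01 p) fAB) => x y _.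
have [Z /= [Zx Zy Zs]] := dyadic_fun_midpoints x y p0 e0 e1.
have M0 := mean_dist_ge0 p x y.
have pn1 : (p <= 1) = false by apply/negbTE; rewrite -ltNge.
rewrite /dyadic_dist /dist_of_power pn1.
move: Zx Zy Zs M0; set M := mean _; set kappa := (_ + _) / 2.
move=> Zx Zy Zs M0.
have kap : kappa <= ((1 + d) / 2) `^ p.
  have E (s : R) : 0 <= s -> (s / 2) `^ p = 2^-1 `^ p * s `^ p.
    by move=> s0; rewrite powRM ?invr_ge0// mulrC.
  rewrite /kappa !E; try lra.
  rewrite -mulrDr -mulrA ler_pM2l ?powR_gt0//.
  apply: (le_trans (powR_mean_le p0 e0 e1 _)); first lra.
  by rewrite pe; apply: le1r_powR; lra.
have kap0 : 0 <= kappa by rewrite divr_ge0 ?addr_ge0 ?powR_ge0.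
have mid : (kappa * M) `^ p^-1 <= (1 + d) / 2 * M `^ p^-1.
  rewrite powRM//; apply: ler_wpM2r; first exact: powR_ge0.
  have h2 : 0 <= (1 + d) / 2 by lra.
  have -> : (1 + d) / 2 = (((1 + d) / 2) `^ p) `^ p^-1.
    by rewrite -powRrM divff ?powRr1// gt_eqF.
  by apply: ge0_ler_powR; rewrite ?nnegrE ?powR_ge0// invr_ge0 ltW.
exists Z; split => [n|n|n m nm]; rewrite ?Zx ?Zy ?Zs//.
rewrite [leRHS]powRM//; last by rewrite divr_ge0 ?powR_ge0.
rewrite (powRM _ (powR_ge0 _ _)) ?invr_ge0//.
rewrite -[in leRHS]powRrM divff ?gt_eqF// powRr1//.
by rewrite [e * _]mulrC.
Qed.

End NoEmbedding.
(** * No embedding when p > 1 and q > 2 *)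

Section Hamming.
Context {R : realType}.
Implicit Types (p q : R).

Definition rad_sum (s : seq nat) (t : R) : R := \sum_(n <- s) rademacher n t.

Lemma dyadic_rad_sum s : exists n, dyadic n (rad_sum s).
Proof.
elim: s => [|m s [n IH]].
  by exists 0%N, (fun=> 0) => t; rewrite /rad_sum big_nil.
exists (maxn m.+1 n); rewrite (_ : rad_sum _ = fun t => rademacher m t + rad_sum s t).
  apply: (dyadic_comp2 (fun a b => a + b)).
    by apply: dyadic_le (dyadic_rademacher m); exact: leq_maxl.
  by apply: dyadic_le IH; exact: leq_maxr.
by apply/funext => t; rewrite /rad_sum big_cons.
Qed.

Definition rad_sum_fun s : @dyadic_fun R := exist _ _ (dyadic_rad_sum s).

(** Odd powers of the Rademacher function cancel by independence. *)
Lemma mean_add_rademacher n (S : R -> R) (c : R) : c ^+ 2 = 1 -> dyadic n S ->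
  mean (fun t => (S t + c * rademacher n t) ^+ 2) = mean (fun t => S t ^+ 2) + 1 /\
  mean (fun t => (S t + c * rademacher n t) ^+ 4) =
    mean (fun t => S t ^+ 4) + 6 * mean (fun t => S t ^+ 2) + 1.
Proof.
move=> c2 dS.
have d1 : dyadic n (fun=> 1 : R) by exact: dyadic_cst.
have dS2 : dyadic n (fun t => S t ^+ 2) by exact: (dyadic_comp (fun a => a ^+ 2)).
have dS4 : dyadic n (fun t => S t ^+ 4) by exact: (dyadic_comp (fun a => a ^+ 4)).
have ge4 (x : R) : 0 <= x ^+ 4 by rewrite (exprM x 2 2) sqr_ge0.
have ge2 (x : R) : 0 <= x ^+ 2 by exact: sqr_ge0.
have c4 : c ^+ 4 = 1 by rewrite (exprM c 2 2) c2 expr1n.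
split.
- rewrite (@mean_rademacher _ n (fun t s => (S t + c * s) ^+ 2)) => //; last 2 first.
  + exact: (dyadic_comp (fun a => (a + c * 1) ^+ 2)).
  + exact: (dyadic_comp (fun a => (a + c * -1) ^+ 2)).
  rewrite -(@meanD _ n)//; last 2 first.
  + exact: (dyadic_comp (fun a => (a + c * 1) ^+ 2)).
  + exact: (dyadic_comp (fun a => (a + c * -1) ^+ 2)).
  have -> : (fun t => (S t + c * 1) ^+ 2 + (S t + c * -1) ^+ 2) =
      (fun t => 2 * (S t ^+ 2 + 1)).
    apply/funext => t; transitivity (2 * (S t ^+ 2 + c ^+ 2)); first by ring.
    by rewrite c2.
  rewrite (@meanZ _ n)//; last 2 first.
  + exact: (dyadic_comp (fun a => a ^+ 2 + 1)).
  + by move=> t; rewrite addr_ge0.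
  rewrite (@meanD _ n)// mean_cst//.
  by field.
- rewrite (@mean_rademacher _ n (fun t s => (S t + c * s) ^+ 4)) => //; last 2 first.
  + exact: (dyadic_comp (fun a => (a + c * 1) ^+ 4)).
  + exact: (dyadic_comp (fun a => (a + c * -1) ^+ 4)).
  rewrite -(@meanD _ n)//; last 2 first.
  + exact: (dyadic_comp (fun a => (a + c * 1) ^+ 4)).
  + exact: (dyadic_comp (fun a => (a + c * -1) ^+ 4)).
  have -> : (fun t => (S t + c * 1) ^+ 4 + (S t + c * -1) ^+ 4) =
      (fun t => 2 * (S t ^+ 4 + 6 * S t ^+ 2 + 1)).
    apply/funext => t.
    transitivity (2 * (S t ^+ 4 + 6 * (c ^+ 2) * S t ^+ 2 + c ^+ 4)); first by ring.
    by rewrite c2 c4 mulr1.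
  have d6 : dyadic n (fun t => 6 * S t ^+ 2) by exact: (dyadic_comp (fun a => 6 * a ^+ 2)).
  have g6 t : 0 <= 6 * S t ^+ 2 by rewrite mulr_ge0.
  have d46 : dyadic n (fun t => S t ^+ 4 + 6 * S t ^+ 2).
    exact: (dyadic_comp (fun a => a ^+ 4 + 6 * a ^+ 2)).
  have g46 t : 0 <= S t ^+ 4 + 6 * S t ^+ 2 by rewrite addr_ge0.
  rewrite (@meanZ _ n)//; last 2 first.
  + exact: (dyadic_comp (fun a => a ^+ 4 + 6 * a ^+ 2 + 1)).
  + by move=> t; rewrite addr_ge0.
  rewrite (@meanD _ n)// (@meanD _ n)// (@meanZ _ n)// mean_cst//.
  by field.
Qed.

Definition rad_diff (w : seq (nat * nat)) (t : R) : R :=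
  rad_sum (unzip1 w) t - rad_sum (unzip2 w) t.

(** The indices decrease along the list, so the Rademacher functions of the first
    pair are independent of the sum over the other pairs. *)
Lemma rad_diff_moments n (w : seq (nat * nat)) :
  path gtn n (flatten [seq [:: ab.2; ab.1] | ab <- w]) ->
  [/\ dyadic n (rad_diff w),
      mean (fun t => rad_diff w t ^+ 2) = (2 * size w)%:R &
      mean (fun t => rad_diff w t ^+ 4) <= 3 * (2 * size w)%:R ^+ 2].
Proof.
elim: w n => [|[a b] w IH] n /=.
  move=> _; have E : rad_diff [::] = fun=> 0.
    by apply/funext => t; rewrite /rad_diff /rad_sum /= !big_nil subrr.
  rewrite E muln0; split; first exact: dyadic_cst.
  - by rewrite expr0n/= mean_cst.
  - by rewrite !expr0n/= mean_cst// mulr0.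
case/and3P => bn ab /IH[dS S2 S4].
set S := rad_diff w in dS S2 S4.
have E : rad_diff ((a, b) :: w) = fun t => (S t + 1 * rademacher a t) + -1 * rademacher b t.
  apply/funext => t; rewrite /S /rad_diff /rad_sum /= !big_cons; ring.
have dS1 : dyadic a.+1 (fun t => S t + 1 * rademacher a t).
  exact: (dyadic_comp2 (fun x y => x + 1 * y) (dyadic_le (leqnSn a) dS) (dyadic_rademacher a)).
have [T2 T4] := mean_add_rademacher (expr1n _ 2) dS.
have N2 : (-1 : R) ^+ 2 = 1 by rewrite sqrrN expr1n.
have [V2 V4] := mean_add_rademacher N2 (dyadic_le ab dS1).
rewrite E; split.
- apply: dyadic_le bn _.
  exact: (dyadic_comp2 (fun x y => x + -1 * y)
    (dyadic_le (leqW ab) dS1) (dyadic_rademacher b)).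
- rewrite V2 T2 S2 mulnS natrD; ring.
- rewrite V4 T4 T2 S2 mulnS natrD; move: S4.
  have : 0 <= (2 * size w)%:R :> R by [].
  lra.
Qed.

(** Khintchine's lower bound, by a pointwise comparison with moments. Put
    y = S^2/(2k), so that y has mean 1 and y^2 has mean at most 3. Where
    y <= 1/4, y/2 <= 1/8. Where y > 1/4, |S|^p > b = (k/2)^(p/2), and
    y/2 <= 1 + 1/8 + y^2/16. So b y/2 <= |S|^p + b/8 + b y^2/16 everywhere, and
    taking means gives b/2 <= mean |S|^p + b/8 + 3b/16. *)
Lemma rad_diff_lower p n (w : seq (nat * nat)) : 0 < p -> (0 < size w)%N ->
  path gtn n (flatten [seq [:: ab.2; ab.1] | ab <- w]) ->
  3 / 16 * ((size w)%:R / 2) `^ (p / 2) <= mean (fun t => `|rad_diff w t| `^ p).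
Proof.
move=> p0 w0 /rad_diff_moments[dS S2 S4]; set S := rad_diff w in dS S2 S4 *.
set k : R := (size w)%:R.
have k0 : 0 < k by rewrite ltr0n.
move: S2 S4; rewrite natrM -/k => S2 S4.
set b := (k / 2) `^ (p / 2); have b0 : 0 < b by rewrite powR_gt0// divr_gt0.
pose F t := b * (4 * k)^-1 * S t ^+ 2.
pose G t := `|S t| `^ p + (b / 8 + b * (64 * k ^+ 2)^-1 * S t ^+ 4).
have ge4 (x : R) : 0 <= x ^+ 4 by rewrite (exprM x 2 2) sqr_ge0.
have FG t : F t <= G t.
  rewrite /F /G; set y := S t ^+ 2 / (2 * k).
  have y0 : 0 <= y by rewrite divr_ge0 ?sqr_ge0// mulr_ge0// ltW.
  have -> : b * (4 * k)^-1 * S t ^+ 2 = b * y / 2 by rewrite /y; field; rewrite gt_eqF.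
  have -> : b * (64 * k ^+ 2)^-1 * S t ^+ 4 = b * y ^+ 2 / 16.
    by rewrite /y; field; rewrite gt_eqF.
  (* 4^-1 is where |S|^2 reaches k/2, the value at which |S|^p reaches b *)
  have [y4|y4] := leP y (4^-1).
    have : 0 <= b * (4^-1 - y) by rewrite mulr_ge0 ?subr_ge0// ltW.
    have : 0 <= b * y ^+ 2 by rewrite mulr_ge0 ?sqr_ge0// ltW.
    have := powR_ge0 `|S t| p.
    lra.
  have : b <= `|S t| `^ p.
    have -> : `|S t| `^ p = (S t ^+ 2) `^ (p / 2).
      have -> : S t ^+ 2 = `|S t| `^ 2%:R.
        by rewrite powR_mulrn// real_normK// num_real.
      by rewrite -powRrM; congr (_ `^ _); field.
    rewrite /b; apply: ge0_ler_powR; rewrite ?nnegrE ?sqr_ge0 ?divr_ge0 ?(ltW k0) ?(ltW p0)//.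
    move: y4; rewrite /y ltr_pdivlMr ?mulr_gt0//; lra.
  have : 0 <= b * (y - 4) ^+ 2 by rewrite mulr_ge0 ?sqr_ge0// ltW.
  have : 0 <= b * (y - 4^-1) by rewrite mulr_ge0 ?subr_ge0// ltW.
  lra.
have dF : dyadic n F by exact: (dyadic_comp (fun a => b * (4 * k)^-1 * a ^+ 2)).
have c2 : 0 <= b * (4 * k)^-1 by rewrite mulr_ge0 ?invr_ge0 ?mulr_ge0// ltW.
have c4 : 0 <= b * (64 * k ^+ 2)^-1.
  by rewrite mulr_ge0 ?invr_ge0 ?mulr_ge0 ?sqr_ge0// ltW.
have dG : dyadic n G.
  exact: (dyadic_comp (fun a => `|a| `^ p + (b / 8 + b * (64 * k ^+ 2)^-1 * a ^+ 4))).
have F0 t : 0 <= F t by rewrite mulr_ge0// sqr_ge0.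
have b8 : 0 <= b / 8 by rewrite divr_ge0// ltW.
have dS2 : dyadic n (fun t => S t ^+ 2) by exact: (dyadic_comp (fun a => a ^+ 2)).
have dS4 : dyadic n (fun t => S t ^+ 4) by exact: (dyadic_comp (fun a => a ^+ 4)).
have := mean_le dF dG F0 FG.
have dSp : dyadic n (fun t => `|S t| `^ p) by exact: (dyadic_comp (fun a => `|a| `^ p)).
pose H t := b * (64 * k ^+ 2)^-1 * S t ^+ 4.
have dH : dyadic n H by exact: (dyadic_comp (fun a => b * (64 * k ^+ 2)^-1 * a ^+ 4)).
have H0 t : 0 <= H t by rewrite mulr_ge0.
have dbH : dyadic n (fun t => b / 8 + H t) by exact: (dyadic_comp2 +%R (dyadic_cst n (b / 8)) dH).
have bH0 t : 0 <= b / 8 + H t by rewrite addr_ge0.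
have -> : mean F = b * (4 * k)^-1 * mean (fun t => S t ^+ 2).
  by apply: (meanZ dS2) => // t; exact: sqr_ge0.
have -> : mean G = mean (fun t => `|S t| `^ p) + mean (fun t => b / 8 + H t).
  by apply: (meanD dSp dbH) => // t; exact: powR_ge0.
rewrite (meanD (dyadic_cst n (b / 8)) dH)// /H.
rewrite mean_cst// (@meanZ _ n)// S2.
have : b * (64 * k ^+ 2)^-1 * mean (fun t => S t ^+ 4) <=
    b * (64 * k ^+ 2)^-1 * (3 * (2 * k) ^+ 2).
  exact: ler_wpM2l.
have -> : b * (64 * k ^+ 2)^-1 * (3 * (2 * k) ^+ 2) = b * 3 / 16.
  by field; rewrite gt_eqF.
have -> : b * (4 * k)^-1 * (2 * k) = b / 2 by field; rewrite gt_eqF.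
lra.
Qed.

Lemma no_embedding_gt2 p q : 1 < p -> 2 < q ->
  ~ lipschitz_embeds (@Lp_dist R p) (@lp_dist R q).
Proof.
move=> p1 q2; have p0 : 0 < p by lra. have q0 : 0 < q by lra.
move=> /(embeds_dyadic p0)[f [A [B [A0 B0 fAB]]]].
have pn1 : (p <= 1) = false by apply/negbTE; rewrite -ltNge.
have qe : norm_exp q = q by apply/max_idPr; lra.
pose F s := sval (f (rad_sum_fun s)).
(* changing one index moves the sum by at most 2, hence its image by 2 B *)
pose L := (2 * B) `^ q.
have FL s t a b : power_sum_bounded q (fun i => F (s ++ a :: t) i - F (s ++ b :: t) i) L.
  have [d0 dB] := power_sum_bounded_lp_dist (f (rad_sum_fun (s ++ a :: t)))
    (f (rad_sum_fun (s ++ b :: t))) q0.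
  move=> N; apply: le_trans (dB N) _; rewrite qe /L.
  apply: ge0_ler_powR; rewrite ?nnegrE ?mulr_ge0 ?(ltW B0) ?(ltW q0)//.
  have /andP[_ /le_trans] := fAB (rad_sum_fun (s ++ a :: t)) (rad_sum_fun (s ++ b :: t)).
  apply; rewrite [leRHS]mulrC ler_pM2l//.
  have -> : 2 = dist_of_power p (2 `^ p).
    by rewrite /dist_of_power pn1 -powRrM divff ?powRr1// gt_eqF.
  rewrite /dyadic_dist; apply: ler_dist_of_power; first exact: mean_dist_ge0.
  have [n [xn yn]] := dyadic_common (rad_sum_fun (s ++ a :: t)) (rad_sum_fun (s ++ b :: t)).
  rewrite -[leRHS]mean_cst ?powR_ge0//.
  apply: (@mean_le _ n) => [||u|u]; last 2 first.
  - exact: powR_ge0.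
  - apply: ge0_ler_powR; rewrite ?nnegrE// ?(ltW p0)//=.
    rewrite /rad_sum !big_cat/= !big_cons.
    rewrite (_ : _ - _ = rademacher a u - rademacher b u); last by ring.
    by case: (rademacherP a u) => ->;
      case: (rademacherP b u) => ->; rewrite ler_norml; apply/andP; split; lra.
  - exact: (dyadic_comp2 (fun a b => `|a - b| `^ p) xn yn).
  - exact: dyadic_cst.
pose C := 2 * (1 + quasi_cst q * (1 + L)).
have L0 : 0 <= L by exact: powR_ge0.
have C0 : 0 < C.
  by rewrite mulr_gt0// addr_gt0// mulr_gt0 ?quasi_cst_gt0// ltr_wpDr.
pose c := (3 / 16) `^ p^-1 * 2^-1 `^ 2^-1 : R.
have c0 : 0 < A^-1 * c by rewrite !mulr_gt0 ?powR_gt0 ?invr_gt0//; lra.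
have q12 : q^-1 < 2^-1 by rewrite ltf_pV2 ?posrE.
have [k Hk] := powR_large_scale q12 c0 (powR_gt0 q^-1 C0).
have [w [wk ws wF]] := hamming_concentration (k := k.+1) q0 (fun s t a b _ => FL s t a b).
set x := rad_sum_fun (unzip1 w); set y := rad_sum_fun (unzip2 w).
have up : lp_dist (f x) (f y) <= C `^ q^-1 * k.+1%:R `^ q^-1.
  apply: le_trans (lp_dist_le q0 wF) _.
  have kC : 0 <= k.+1%:R * C by rewrite mulr_ge0// ltW.
  by rewrite -/C (dist_of_powerE _ kC) qe mulrC (powRM _ (ltW C0)).
have path_w : exists n, path gtn n (flatten [seq [:: ab.2; ab.1] | ab <- w]).
  move: ws; case: (flatten _) => [|m l] /=; first by exists 0%N.
  by exists m.+1; rewrite /= leqnn.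
have [n nw] := path_w.
have w0 : (0 < size w)%N by rewrite wk.
have low : c * k.+1%:R `^ 2^-1 <= dyadic_dist p x y.
  have H := rad_diff_lower p0 w0 nw.
  have -> : c * k.+1%:R `^ 2^-1 = dist_of_power p (3 / 16 * (k.+1%:R / 2) `^ (p / 2)).
    have h316 : 0 <= 3 / 16 :> R by lra.
    have h2 : 0 <= 2^-1 :> R by lra.
    rewrite /dist_of_power pn1 (powRM _ h316 (powR_ge0 _ _)) -powRrM.
    rewrite (_ : p / 2 * p^-1 = 2^-1); last by field; rewrite gt_eqF.
    rewrite (powRM _ (ler0n R k.+1) h2).
    by rewrite /c -mulrA [2^-1 `^ _ * _]mulrC.
  apply: ler_dist_of_power; last by move: H; rewrite wk.
  by rewrite mulr_ge0 ?powR_ge0//; lra.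
have /andP[lo _] := fAB x y.
have : A^-1 * (c * k.+1%:R `^ 2^-1) <= C `^ q^-1 * k.+1%:R `^ q^-1.
  by apply: le_trans up; apply: le_trans lo; rewrite ler_pM2l ?invr_gt0.
by rewrite mulrA leNgt Hk.
Qed.

End Hamming.

Theorem proposition4p3 (R : realType) (p q : R) (p_gt0 : 0 < p) (q_gt0 : 0 < q)
    (p_neq2 : p <> 2) (q_neq2 : q <> 2) :
  ~ lipschitz_embeds (@Lp_dist R p) (@lp_dist R q).
Proof.
have [p1|p1] := leP p 1; first exact: no_embedding_le1.
have [q2|q2|q2] := ltgtP q 2; last by case: q_neq2.
- exact: no_embedding_lt2.
- exact: no_embedding_gt2.
Qed.
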